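(* Let $U$ and $V$ be groups with torsion, $G=(U\wr\mathbb{Z})\times(V\wr\mathbb{Z})$, $e$ a nontrivial projection in $\mathbb{C}[U]$ and $f$ a nontrivial projection in $\mathbb{C}[V]$. Let $X=(\mathrm{tr}_U(e))^{-1}$ and $Y=(\mathrm{tr}_V(f))^{-1}$ (so $X>1$, $Y>1$). Let $T=e\,t_U+t_U^{-1}e\in\mathbb{C}[U\wr\mathbb{Z}]\subset\mathbb{C}[G]$ and $S=f\,t_V+t_V^{-1}f\in\mathbb{C}[V\wr\mathbb{Z}]\subset\mathbb{C}[G]$. Then \[ \dim_G(\ker(T-S))=(X-1)^2(Y-1)^2\Big(\sum_{m\ge1}\sum_{n\ge1}\frac{\gcd(m,n)}{X^mY^n}\Big)-(X-1)(Y-1). \]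
   Context: For a group $U$, $U\wr\mathbb{Z}=(\bigoplus_{i\in\mathbb{Z}}U)\rtimes C_\infty$, where $C_\infty$ is infinite cyclic with generator $t_U$ acting by the shift $t_U^{-1}((g_n)_{n})t_U=(g_{n-1})_n$; $U$ is identified with the subgroup of elements $(\dots,1,u,1,\dots)$ with $u$ in position $0$. A nontrivial projection means $p=p^*=p^2$, $p\ne0,1$. For a group $H$, $\mathrm{tr}_H$ on $\mathbb{C}[H]$ is the coefficient of $1$, extended to the group von Neumann algebra $\mathcal N(H)$ by $\mathrm{tr}_H(a)=\langle a(1),1\rangle_{l^2(H)}$; elements of $\mathbb{C}[G]$ act on $l^2(G)$ by left multiplication, and $\dim_G(\ker(T-S))$ is $\mathrm{tr}_G$ of the orthogonal projection of $l^2(G)$ onto $\ker(T-S)$. *)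

(* Defs.v *)
From HB Require Import structures.
From mathcomp Require Import all_boot all_order all_algebra finmap.
From mathcomp Require Import complex.
From mathcomp Require Import boolp classical_sets functions cardinality fsbigop reals ereal esum.

Set Implicit Arguments.
Unset Strict Implicit.
Unset Printing Implicit Defensive.

Import Order.TTheory GRing.Theory Num.Theory.

Local Open Scope fset_scope.

(* The restricted wreath product U wr Z = (\bigoplus_{i in Z} U) x| C_oo *)
(* An element is a pair (f, k) standing for f * t^k, where f : Z -> U   *)
(* is finitely supported (f n <> 1 only for finitely many n).           *)
(* With t^{-1} (g_n)_n t = (g_{n-1})_n, one computes                    *)
(*   (f, a) * (g, b) = (n |-> f n * g (n + a), a + b)                   *)
(*   (f, a)^{-1}     = (n |-> (f (n - a))^{-1}, - a).                   *)

Section Wreath.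
Variable U : groupType.

Definition fsU := {fsfun int -> U with 1%g}.

Record wreath := Wreath { wbase : fsU; wexp : int }.

Definition wreath_to (x : wreath) : fsU * int := (wbase x, wexp x).
Definition wreath_of (p : fsU * int) : wreath := Wreath p.1 p.2.
Lemma wreath_toK : cancel wreath_to wreath_of. Proof. by case. Qed.

HB.instance Definition _ := Equality.copy wreath (can_type wreath_toK).
HB.instance Definition _ := Choice.copy wreath (can_type wreath_toK).

Definition shiftf (a : int) (g : fsU) : fsU :=
  [fsfun n in [fset (k - a)%R | k in finsupp g] => g (n + a)%R | 1%g].
Definition mulf (f g : fsU) : fsU :=
  [fsfun n in finsupp f `|` finsupp g => (f n * g n)%g | 1%g].
Definition invf (f : fsU) : fsU :=
  [fsfun n in finsupp f => ((f n)^-1)%g | 1%g].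
Definition onef : fsU := [fsfun for (fun _ : int => 1%g)].

Definition wmul (x y : wreath) : wreath :=
  Wreath (mulf (wbase x) (shiftf (wexp x) (wbase y))) (wexp x + wexp y)%R.
Definition winv (x : wreath) : wreath :=
  Wreath (shiftf (- wexp x)%R (invf (wbase x))) (- wexp x)%R.
Definition wone : wreath := Wreath onef 0%R.

Lemma onefE n : onef n = 1%g.
Proof. by rewrite /onef fsfun0E. Qed.

Lemma mulfE f g n : mulf f g n = (f n * g n)%g.
Proof.
rewrite /mulf fsfun_fun in_fsetU.
case: finsuppP => // _; case: finsuppP => // _.
by rewrite mulg1.
Qed.

Lemma invfE f n : invf f n = ((f n)^-1)%g.
Proof. by rewrite /invf fsfun_fun; case: finsuppP => // _; rewrite invg1. Qed.

Lemma shiftfE a g n : shiftf a g n = g (n + a)%R.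
Proof.
rewrite /shiftf fsfun_fun.
case: ifP => // /negbT Hn.
case: finsuppP => // Hin; exfalso; move/negP: Hn; apply.
by apply/imfsetP; exists (n + a)%R => //=; exact: (esym (@GRing.addrK int a n)).
Qed.

Lemma wmulA : associative wmul.
Proof.
move=> [f a] [g b] [h c]; rewrite /wmul /=; congr Wreath; last first.
  by rewrite GRing.addrA.
apply/fsfunP => n; rewrite !(mulfE, shiftfE) mulgA; congr (_ * _)%g.
by rewrite GRing.addrA.
Qed.

Lemma wmul1 : left_id wone wmul.
Proof.
move=> [f a]; rewrite /wmul /=; congr Wreath; last by rewrite GRing.add0r.
by apply/fsfunP => n; rewrite mulfE shiftfE onefE mul1g GRing.addr0.
Qed.

Lemma wmulr1 : right_id wone wmul.
Proof.
move=> [f a]; rewrite /wmul /=; congr Wreath; last by rewrite GRing.addr0.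
by apply/fsfunP => n; rewrite mulfE shiftfE onefE mulg1.
Qed.

Lemma wmulV : left_inverse wone winv wmul.
Proof.
move=> [f a]; rewrite /wmul /wone /=; congr Wreath; last by rewrite GRing.addNr.
apply/fsfunP => n; rewrite mulfE !shiftfE !invfE onefE.
by rewrite mulVg.
Qed.

Lemma wmulVr : right_inverse wone winv wmul.
Proof.
move=> [f a]; rewrite /wmul /wone /=; congr Wreath; last by rewrite GRing.subrr.
apply/fsfunP => n; rewrite mulfE !shiftfE !invfE onefE.
by rewrite (@GRing.addrK int) mulgV.
Qed.

HB.instance Definition _ :=
  isGroup.Build wreath wmulA wmul1 wmulr1 wmulV wmulVr.

Definition wembed (u : U) : wreath :=
  Wreath [fsfun n in [fset 0%R] => u | 1%g] 0%R.

Definition wgen : wreath := Wreath onef 1%R.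

End Wreath.

Section GProd.
Variables A B : groupType.
Record gprod := GPair { gfst : A; gsnd : B }.
Definition gprod_to (x : gprod) : A * B := (gfst x, gsnd x).
Definition gprod_of (p : A * B) : gprod := GPair p.1 p.2.
Lemma gprod_toK : cancel gprod_to gprod_of. Proof. by case. Qed.
HB.instance Definition _ := Equality.copy gprod (can_type gprod_toK).
HB.instance Definition _ := Choice.copy gprod (can_type gprod_toK).
Definition pmul (x y : gprod) := GPair (gfst x * gfst y)%g (gsnd x * gsnd y)%g.
Definition pinv (x : gprod) := GPair (gfst x)^-1%g (gsnd x)^-1%g.
Definition pone := GPair (1%g : A) (1%g : B).
Lemma pmulA : associative pmul.
Proof. by move=> [? ?] [? ?] [? ?]; rewrite /pmul /= !mulgA. Qed.
Lemma pmul1 : left_id pone pmul.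
Proof. by move=> [? ?]; rewrite /pmul /= !mul1g. Qed.
Lemma pmulr1 : right_id pone pmul.
Proof. by move=> [? ?]; rewrite /pmul /= !mulg1. Qed.
Lemma pmulV : left_inverse pone pinv pmul.
Proof. by move=> [? ?]; rewrite /pmul /= !mulVg. Qed.
Lemma pmulVr : right_inverse pone pinv pmul.
Proof. by move=> [? ?]; rewrite /pmul /= !mulgV. Qed.
HB.instance Definition _ := isGroup.Build gprod pmulA pmul1 pmulr1 pmulV pmulVr.
Definition inl_g (a : A) : gprod := GPair a 1%g.
Definition inr_g (b : B) : gprod := GPair 1%g b.
End GProd.

Section GroupRing.
Variable R : realType.
Local Notation C := R[i].
Local Open Scope ring_scope.
Local Open Scope classical_set_scope.

Section OneGroup.
Variable G : groupType.

Definition fin_supp (a : G -> C) : Prop := finite_set [set g | a g != 0].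

(* left convolution; for a in C[G] and xi : G -> C this is the action of
   a on xi by left multiplication (and, for xi in C[G], the product). *)
Definition conv (a xi : G -> C) : G -> C :=
  fun g => \sum_(h \in [set h | a h != 0]) a h * xi (h^-1 * g)%g.

Definition delta (x : G) : G -> C := fun g => if g == x then 1 else 0.

Definition gstar (a : G -> C) : G -> C := fun g => conjc (a (g^-1)%g).

Definition nontriv_proj (p : G -> C) : Prop :=
  [/\ fin_supp p, conv p p = p, gstar p = p, p <> (fun=> 0) & p <> delta 1%g].

Definition gtr (a : G -> C) : C := a 1%g.

Definition sqnormc (z : C) : R := (complex.Re z) ^+ 2 + (complex.Im z) ^+ 2.

Definition l2sqnorm (xi : G -> C) : \bar R :=
  esum [set: G] (fun g => (sqnormc (xi g))%:E).

Definition in_l2 (xi : G -> C) : Prop := (l2sqnorm xi < +oo)%E.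

Definition l2ker (a : G -> C) : set (G -> C) :=
  [set xi | in_l2 xi /\ conv a xi = (fun=> 0)].

(* xi is the image of x under the orthogonal projection onto the closed
   subspace K, i.e. the (unique) point of K nearest to x. *)
Definition is_orth_proj (K : set (G -> C)) (x xi : G -> C) : Prop :=
  K xi /\ forall eta, K eta ->
    (l2sqnorm (fun g => (x g - xi g)%R) <= l2sqnorm (fun g => (x g - eta g)%R))%E.

End OneGroup.

(* pushforward of a finitely supported function along a map
   (for an injective homomorphism: the inclusion C[A] -> C[B]) *)
Definition push (A B : groupType) (phi : A -> B) (a : A -> C) : B -> C :=
  fun b => \sum_(h \in [set h | a h != 0 /\ phi h = b]) a h.

End GroupRing.

Definition has_torsion (U : groupType) : Prop :=
  exists u : U, u != 1%g /\ exists n : nat, (0 < n)%N /\ (u ^+ n)%g = 1%g.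

Definition gcd_series (R : realType) (X Y : R) : \bar R :=
  esum [set mn : nat * nat | (0 < mn.1)%N /\ (0 < mn.2)%N]
     (fun mn => ((gcdn mn.1 mn.2)%:R / (X ^+ mn.1 * Y ^+ mn.2))%:E)%R.

(* Main.v *)
(* Put e_k = t^k e t^-k in C[U wr Z]. The elements D_m = (1 - e_0) e_1 ... e_m (1 - e_(m+1))
   are projections, and the t^-i D_m t^j (1 <= i, j <= m + 1) are matrix units of a block
   on which T acts as the adjacency matrix of a path with m + 1 vertices. These blocks are
   mutually orthogonal, and the traces of their identities add up to 1. On the product of
   two blocks T - S acts as W |-> A W - W A', with A and A' the adjacency matrices of
   paths with m + 1 and n + 1 vertices, whose kernel has dimension gcd(m + 2, n + 2) - 1.
   The orthogonal projections onto these finite-dimensional kernels are given by elements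
   of C[G], and the sum of these elements converges in l^2(G) to the projection of the
   identity element onto ker (T - S). *)
Require Import Defs.
From HB Require Import structures.
From mathcomp Require Import all_boot all_order all_algebra finmap.
From mathcomp Require Import complex.
From mathcomp Require Import boolp classical_sets functions cardinality fsbigop reals ereal esum.
From mathcomp Require Import topology normedtype sequences.
From mathcomp Require Import zify ring lra.

Import Order.TTheory GRing.Theory Num.Theory.
Import numFieldNormedType.Exports.

Set Implicit Arguments.
Unset Strict Implicit.
Unset Printing Implicit Defensive.

Local Open Scope ring_scope.

(** * The group algebra *)

(** Read the $e_k$ as independent events of probability $p=\mathrm{tr}(e)$. The diagonal unit
    $t^{-i}D_mt^i$ equals $(1-e_{-i})e_{1-i}\cdots e_{m-i}(1-e_{m+1-i})$: the nearest failures on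
    the two sides of the cut between the indices $-1$ and $0$ enclose exactly $m$ successes. There
    are $m+1$ positions for this, each of trace $(1-p)^2p^m$, and such failures exist almost surely;
    hence the total trace 1. With $X=1/p$ the weight is $(X-1)^2X^{-(m+2)}$, which accounts for the
    prefactor and for the exponents matching the arguments of the gcd; the $-1$ in the kernel
    dimension sums to $(X-1)(Y-1)$.

    The obstacle is that the projection onto the kernel lies outside $\mathbb{C}[G]$: it is
    specified through the point of the kernel nearest to the identity element. The algebra stays
    inside $\mathbb{C}[G]$, and an arbitrary kernel vector $\eta$ enters only through the expansion
    of $\|\eta-a\|^2$ for finitely supported $a$. What the $N$-th partial sum of kernel projections
    misses from 1 splits into $B_N(T-S)$, which kills $\eta$, and a projection whose trace tends to
    0. *)

Section GroupAlgebraType.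
Local Open Scope classical_set_scope.
Variables (R : realType) (G : groupType).
Local Notation C := R[i].

(** Bundling the finite support gives $\mathbb{C}[G]$ a library ring structure, while the coercion
    [gval] keeps [conv] available for the action on arbitrary functions. *)
Record galg := GAlg { gval :> G -> C; gvalP : fin_supp gval }.

HB.instance Definition _ := gen_eqMixin galg.
HB.instance Definition _ := gen_choiceMixin galg.

Implicit Types (a b c : galg) (xi : G -> C).

Lemma galg_eq a b : (forall g, a g = b g) -> a = b.
Proof.
case: a b => [a Pa] [b Pb] /= /funext ab; rewrite ab in Pa *.
by congr GAlg; exact: Prop_irrelevance.
Qed.

Definition gsupp a : {fset G} := fset_set [set g | a g != 0].

Lemma in_gsupp a g : (g \in gsupp a) = (a g != 0).
Proof.
have fa : finite_set [set g | a g != 0] by exact: (gvalP a).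
by rewrite /gsupp in_fset_set //; apply/idP/idP; rewrite in_setE.
Qed.

Lemma fin_supp_sub (S : {fset G}) (x : G -> C) :
  (forall g, g \notin S -> x g = 0) -> fin_supp x.
Proof.
by move=> Sa; apply: (finite_subfset S) => g /=; apply: contra_neqT => /Sa ->.
Qed.

Lemma conv_big (S : {fset G}) (x xi : G -> C) g :
  (forall h, h \notin S -> x h = 0) ->
  conv x xi g = \sum_(h <- S) x h * xi (h^-1 * g)%g.
Proof.
move=> Sa; rewrite /conv (fsbig_fwiden (enum_fset S)) //.
  by move=> h /=; apply: contra_neqT => /Sa ->.
by move=> h /= [_ /negP]; rewrite negbK => /eqP ->; rewrite mul0r.
Qed.

Lemma gsupp0 a h : h \notin gsupp a -> a h = 0.
Proof. by rewrite in_gsupp negbK => /eqP. Qed.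

Lemma convE a xi g : conv a xi g = \sum_(h <- gsupp a) a h * xi (h^-1 * g)%g.
Proof. by apply: conv_big => h; exact: gsupp0. Qed.

Lemma conv_delta_l x xi g : conv (@delta R G x) xi g = xi (x^-1 * g)%g.
Proof.
rewrite (@conv_big [fset x]%fset) => [|h]; last first.
  by rewrite in_fset1 /delta => /negPf ->.
by rewrite big_seq_fset1 /delta eqxx mul1r.
Qed.

Lemma convDl a b xi g : conv (fun h => a h + b h) xi g = conv a xi g + conv b xi g.
Proof.
pose S := (gsupp a `|` gsupp b)%fset.
have Sa h : h \notin S -> a h = 0.
  by rewrite in_fsetU negb_or => /andP[/gsupp0].
have Sb h : h \notin S -> b h = 0.
  by rewrite in_fsetU negb_or => /andP[_ /gsupp0].
rewrite !(@conv_big S) // => [|h hS]; last by rewrite Sa ?Sb ?addr0.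
by rewrite -big_split; apply: eq_bigr => h _; rewrite mulrDl.
Qed.

Lemma convZl z a xi g : conv (fun h => z * a h) xi g = z * conv a xi g.
Proof.
rewrite !(@conv_big (gsupp a)) => [|h /gsupp0 //|h /gsupp0 ->]; last first.
  by rewrite mulr0.
by rewrite mulr_sumr; apply: eq_bigr => h _; rewrite mulrA.
Qed.

Lemma gadd_subproof a b : fin_supp (fun h => a h + b h).
Proof.
apply: (@fin_supp_sub (gsupp a `|` gsupp b)%fset) => h.
by rewrite in_fsetU negb_or => /andP[/gsupp0 -> /gsupp0 ->]; rewrite addr0.
Qed.
Definition gadd a b := GAlg (gadd_subproof a b).

Lemma gopp_subproof a : fin_supp (fun h => - a h).
Proof. by apply: (@fin_supp_sub (gsupp a)) => h /gsupp0 ->; rewrite oppr0. Qed.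
Definition gopp a := GAlg (gopp_subproof a).

Lemma gzero_subproof : fin_supp (fun _ : G => 0 : C).
Proof. exact: (@fin_supp_sub fset0). Qed.
Definition gzero := GAlg gzero_subproof.

Lemma gaddA : associative gadd.
Proof. by move=> a b c; apply: galg_eq => g /=; rewrite addrA. Qed.
Lemma gaddC : commutative gadd.
Proof. by move=> a b; apply: galg_eq => g /=; rewrite addrC. Qed.
Lemma gadd0 : left_id gzero gadd.
Proof. by move=> a; apply: galg_eq => g /=; rewrite add0r. Qed.
Lemma gaddN : left_inverse gzero gopp gadd.
Proof. by move=> a; apply: galg_eq => g /=; rewrite addNr. Qed.

HB.instance Definition _ := GRing.isZmodule.Build galg gaddA gaddC gadd0 gaddN.

Lemma gscale_subproof z a : fin_supp (fun h => z * a h).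
Proof. by apply: (@fin_supp_sub (gsupp a)) => h /gsupp0 ->; rewrite mulr0. Qed.
Definition gscale z a := GAlg (gscale_subproof z a).

Lemma gscaleA z w a : gscale z (gscale w a) = gscale (z * w) a.
Proof. by apply: galg_eq => g /=; rewrite mulrA. Qed.
Lemma gscale1 : left_id 1 gscale.
Proof. by move=> a; apply: galg_eq => g /=; rewrite mul1r. Qed.
Lemma gscaleDr : right_distributive gscale +%R.
Proof. by move=> z a b; apply: galg_eq => g /=; rewrite mulrDr. Qed.
Lemma gscaleDl a : {morph gscale^~ a : z w / z + w}.
Proof. by move=> z w; apply: galg_eq => g /=; rewrite mulrDl. Qed.

HB.instance Definition _ :=
  GRing.Zmodule_isLmodule.Build C galg gscaleA gscale1 gscaleDr gscaleDl.

Lemma gvalD a b g : (a + b) g = a g + b g. Proof. by []. Qed.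
Lemma gvalB a b g : (a - b) g = a g - b g. Proof. by []. Qed.
Lemma gval0 g : (0 : galg) g = 0. Proof. by []. Qed.
Lemma gvalZ z a g : (z *: a) g = z * a g. Proof. by []. Qed.

Lemma gval_sum (I : Type) (r : seq I) (P : pred I) (F : I -> galg) g :
  (\sum_(i <- r | P i) F i) g = \sum_(i <- r | P i) F i g.
Proof. by elim/big_rec2: _ => // i y x _ <-. Qed.

Lemma delta_fin_supp x : fin_supp (@delta R G x).
Proof.
by apply: (@fin_supp_sub [fset x]%fset) => g; rewrite in_fset1 /delta => /negPf ->.
Qed.
Definition gdelta x := GAlg (delta_fin_supp x).

Lemma gdeltaE x g : gdelta x g = (g == x)%:R.
Proof. by rewrite /= /delta; case: eqP. Qed.

Lemma galg_expand a : a = \sum_(h <- gsupp a) a h *: gdelta h.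
Proof.
apply: galg_eq => g; rewrite gval_sum.
have [gS|gS] := boolP (g \in gsupp a).
  rewrite (big_fsetD1 g gS) /= /delta eqxx mulr1 big_seq big1 ?addr0 // => h.
  by rewrite in_fsetD1 eq_sym => /andP[/negPf ->]; rewrite mulr0.
rewrite gsupp0 // big_seq big1 // => h hS; rewrite gvalZ gdeltaE.
by case: (eqVneq g h) => [gh|_]; [rewrite gh hS in gS | rewrite mulr0].
Qed.

(* Every statement about the product reduces to group elements by linearity. *)
Lemma galg_ind (Q : galg -> Prop) :
  Q 0 -> (forall a b, Q a -> Q b -> Q (a + b)) ->
  (forall z a, Q a -> Q (z *: a)) -> (forall x, Q (gdelta x)) -> forall a, Q a.
Proof.
by move=> Q0 QD QZ Qd a; rewrite (galg_expand a); apply: big_ind => // *; exact: QZ.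
Qed.

Lemma gmul_subproof a b : fin_supp (conv a b).
Proof.
apply: (@fin_supp_sub [fset (h * k)%g | h in gsupp a, k in gsupp b]%fset) => g gS.
rewrite convE big_seq big1 // => h hS.
rewrite (@gsupp0 b) ?mulr0 //; apply: contra gS => kS.
by apply/imfset2P; exists h => //; exists (h^-1 * g)%g => //; rewrite mulVKg.
Qed.
Definition gmul a b := GAlg (gmul_subproof a b).

Lemma convDr a xi zeta g :
  conv a (fun h => xi h + zeta h) g = conv a xi g + conv a zeta g.
Proof. by rewrite !convE -big_split; apply: eq_bigr => h _; rewrite mulrDr. Qed.

Lemma convZr a z xi g : conv a (fun h => z * xi h) g = z * conv a xi g.
Proof. by rewrite !convE mulr_sumr; apply: eq_bigr => h _; rewrite mulrCA. Qed.

Lemma conv0l xi g : conv (0 : galg) xi g = 0.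
Proof. by rewrite (@conv_big fset0) // big_seq_fset0. Qed.

(** With [xi] arbitrary this is the module law for the action on functions, and with [xi] finitely
    supported the associativity of the product. It precedes the ring structure, so bilinearity is
    unfolded by hand. *)
Lemma conv_gmul a b xi g : conv (gmul a b) xi g = conv a (conv b xi) g.
Proof.
move: g; elim/galg_ind: a => [g|a1 a2 IH1 IH2 g|z a IH g|x g].
- rewrite conv0l (_ : gmul 0 b = 0) ?conv0l //.
  by apply: galg_eq => h; exact: conv0l.
- rewrite (_ : gmul (a1 + a2) b = gmul a1 b + gmul a2 b); last first.
    by apply: galg_eq => h; exact: convDl.
  by rewrite !convDl IH1 IH2.
- rewrite (_ : gmul (z *: a) b = z *: gmul a b); last first.
    by apply: galg_eq => h; exact: convZl.
  by rewrite !convZl IH.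
- rewrite conv_delta_l; elim/galg_ind: b => [|b1 b2 IH1 IH2|z b IH|y].
  + rewrite conv0l (_ : gmul _ 0 = 0) ?conv0l //.
    by apply: galg_eq => h; rewrite /= conv_delta_l.
  + rewrite (_ : gmul _ (b1 + b2) = gmul (gdelta x) b1 + gmul (gdelta x) b2).
      by rewrite !convDl IH1 IH2.
    by apply: galg_eq => h /=; rewrite !conv_delta_l.
  + rewrite (_ : gmul _ (z *: b) = z *: gmul (gdelta x) b).
      by rewrite !convZl IH.
    by apply: galg_eq => h /=; rewrite !conv_delta_l.
  + rewrite (_ : gmul _ (gdelta y) = gdelta (x * y)%g).
      by rewrite !conv_delta_l invgM mulgA.
    apply: galg_eq => h /=; rewrite !conv_delta_l /delta.
    by rewrite (can2_eq (mulVKg x) (mulKg x)).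
Qed.

Lemma gmulA : associative gmul.
Proof. by move=> a b c; apply: galg_eq => g; rewrite /= -conv_gmul. Qed.
Lemma gmul1 : left_id (gdelta 1%g) gmul.
Proof. by move=> a; apply: galg_eq => g; rewrite /= conv_delta_l invg1 mul1g. Qed.
Lemma gmulr1 : right_id (gdelta 1%g) gmul.
Proof.
move=> a; apply: galg_eq => g; rewrite [in RHS](galg_expand a) gval_sum /= convE.
apply: eq_bigr => h _; congr (_ * _).
by rewrite /= /delta (can2_eq (mulVKg h) (mulKg h)) mulg1.
Qed.
Lemma gmulDl : left_distributive gmul +%R.
Proof. by move=> a b c; apply: galg_eq => g; exact: convDl. Qed.
Lemma gmulDr : right_distributive gmul +%R.
Proof. by move=> a b c; apply: galg_eq => g; exact: convDr. Qed.
Lemma gone_neq0 : gdelta 1%g != 0.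
Proof.
apply/eqP => /(congr1 (fun a : galg => a 1%g)); rewrite gdeltaE eqxx gval0.
by move/eqP; rewrite oner_eq0.
Qed.

HB.instance Definition _ :=
  GRing.Zmodule_isNzRing.Build galg gmulA gmul1 gmulr1 gmulDl gmulDr gone_neq0.

Lemma gscaleAl z a b : z *: (a * b) = z *: a * b.
Proof. by apply: galg_eq => g; symmetry; exact: convZl. Qed.
HB.instance Definition _ := GRing.Lmodule_isLalgebra.Build C galg gscaleAl.
Lemma gscaleAr z a b : z *: (a * b) = a * (z *: b).
Proof. by apply: galg_eq => g; symmetry; exact: convZr. Qed.
HB.instance Definition _ := GRing.Lalgebra_isAlgebra.Build C galg gscaleAr.

Lemma gvalM a b g : (a * b) g = conv a b g. Proof. by []. Qed.
Lemma gval1 g : (1 : galg) g = (g == 1%g)%:R. Proof. exact: gdeltaE. Qed.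
Lemma gdelta1 : gdelta 1%g = 1. Proof. by []. Qed.

Lemma gdeltaM x y : gdelta x * gdelta y = gdelta (x * y)%g.
Proof.
apply: galg_eq => h; rewrite gvalM conv_delta_l !gdeltaE.
by rewrite (can2_eq (mulVKg x) (mulKg x)).
Qed.

Lemma gval_deltaM x a g : (gdelta x * a) g = a (x^-1 * g)%g.
Proof. exact: conv_delta_l. Qed.

Lemma gval_Mdelta x a g : (a * gdelta x) g = a (g * x^-1)%g.
Proof.
rewrite gvalM convE [in RHS](galg_expand a) gval_sum; apply: eq_bigr => h _.
by rewrite gvalZ !gdeltaE (can2_eq (mulVKg h) (mulKg h)) (can2_eq (mulgVK _) (mulgK _)).
Qed.

Lemma conv1 xi : conv (1 : galg) xi = xi.
Proof. by apply: funext => g; rewrite conv_delta_l invg1 mul1g. Qed.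

Lemma convM a b xi : conv (a * b) xi = conv a (conv b xi).
Proof. by apply: funext => g; exact: conv_gmul. Qed.

Lemma convD a b xi g : conv (a + b) xi g = conv a xi g + conv b xi g.
Proof. exact: convDl. Qed.

Lemma convZ z a xi g : conv (z *: a) xi g = z * conv a xi g.
Proof. exact: convZl. Qed.

Lemma gstar_subproof a : fin_supp (gstar a).
Proof.
apply: (@fin_supp_sub [fset h^-1%g | h in gsupp a]%fset) => g gS; rewrite /gstar.
rewrite gsupp0 ?rmorph0 //; apply: contra gS => gS.
by apply/imfsetP; exists g^-1%g => //=; rewrite invgK.
Qed.
Definition star a := GAlg (gstar_subproof a).

Lemma gval_star a g : star a g = conjc (a g^-1%g). Proof. by []. Qed.

Lemma starD a b : star (a + b) = star a + star b.
Proof. by apply: galg_eq => g; rewrite /= /gstar /= rmorphD. Qed.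
Lemma star0 : star 0 = 0.
Proof. by apply: galg_eq => g; exact: (rmorph0 (@conjc R)). Qed.
Lemma starN a : star (- a) = - star a.
Proof. by apply: galg_eq => g; rewrite /= /gstar /= rmorphN. Qed.
Lemma starZ z a : star (z *: a) = conjc z *: star a.
Proof. by apply: galg_eq => g; rewrite /= /gstar /= rmorphM. Qed.
Lemma star_sum (I : Type) (r : seq I) (P : pred I) (F : I -> galg) :
  star (\sum_(i <- r | P i) F i) = \sum_(i <- r | P i) star (F i).
Proof. exact: (big_morph star starD star0). Qed.
Lemma starK : involutive star.
Proof. by move=> a; apply: galg_eq => g; rewrite /= /gstar /= /gstar invgK conjcK. Qed.
Lemma star_delta x : star (gdelta x) = gdelta x^-1%g.
Proof.
by apply: galg_eq => g; rewrite gval_star !gdeltaE (can2_eq invgK invgK) conjc_nat.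
Qed.
Lemma star1 : star 1 = 1.
Proof. by rewrite -gdelta1 star_delta invg1. Qed.

Lemma starM a b : star (a * b) = star b * star a.
Proof.
elim/galg_ind: a => [|a1 a2 IH1 IH2|z a IH|x].
- by rewrite mul0r star0 mulr0.
- by rewrite mulrDl !starD IH1 IH2 mulrDr.
- by rewrite -scalerAl !starZ IH scalerAr.
elim/galg_ind: b => [|b1 b2 IH1 IH2|z b IH|y].
- by rewrite mulr0 star0 mul0r.
- by rewrite mulrDr !starD IH1 IH2 mulrDl.
- by rewrite -scalerAr !starZ IH scalerAl.
by rewrite !gdeltaM !star_delta gdeltaM invgM.
Qed.

Lemma comm_supp a b :
  (forall h k, a h != 0 -> b k != 0 -> (h * k = k * h)%g) -> a * b = b * a.
Proof.
move=> ab; rewrite (galg_expand a) (galg_expand b) mulr_suml mulr_sumr.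
rewrite big_seq [RHS]big_seq; apply: eq_bigr => h; rewrite in_gsupp => ah.
rewrite mulr_suml mulr_sumr big_seq [RHS]big_seq; apply: eq_bigr => k.
by rewrite in_gsupp => bk; rewrite -!scalerAl -!scalerAr !gdeltaM scalerA mulrC -scalerA (ab h k).
Qed.

(** In $\sum_h a(h)b(h^{-1})$ only $h=1$ survives. This is the form in which independence of
    commuting projections is used. *)
Lemma trM_indep a b :
  (forall h k, a h != 0 -> b k != 0 -> (h * k = 1)%g -> h = 1%g) ->
  (a * b) 1%g = a 1%g * b 1%g.
Proof.
move=> ab; rewrite gvalM convE.
have zero h : h != 1%g -> a h * b (h^-1 * 1)%g = 0.
  move=> h1; apply/eqP; rewrite mulf_eq0; apply/negPn; rewrite negb_or.
  apply/negP => /andP[ah bh]; move/eqP: h1; apply; apply: (ab h _ ah bh).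
  by rewrite mulg1 mulgV.
have [s1|s1] := boolP (1%g \in gsupp a).
  rewrite (big_fsetD1 1%g s1) /= big_seq big1 ?addr0 ?invg1 ?mul1g // => h.
  by rewrite in_fsetD1 => /andP[h1 _]; exact: zero.
rewrite (gsupp0 s1) mul0r big_seq big1 // => h hS; apply: zero.
by apply: contraNneq s1 => <-.
Qed.

Lemma gmul_supp a b g : (a * b) g != 0 ->
  exists h k, [/\ a h != 0, b k != 0 & g = (h * k)%g].
Proof.
rewrite gvalM convE => abg.
have [h hS bh] : exists2 h, h \in gsupp a & b (h^-1 * g)%g != 0.
  apply/hasP; apply: contraNT abg => /hasPn hb; rewrite big_seq big1 // => h /hb.
  by rewrite negbK => /eqP ->; rewrite mulr0.
by exists h, (h^-1 * g)%g; rewrite -in_gsupp mulVKg.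
Qed.

End GroupAlgebraType.

(** * Push-forward and the square norm *)

Section Push.
Local Open Scope classical_set_scope.
Variables (R : realType) (G H : groupType) (phi : G -> H).
Implicit Types a b : galg R G.

Lemma push_big (S : {fset G}) a x :
  (forall h, h \notin S -> a h = 0) ->
  push phi a x = \sum_(h <- S) a h * (x == phi h)%:R.
Proof.
move=> Sa; pose r := [seq h <- enum_fset S | (a h != 0) && (x == phi h)].
have rP h : (h \in r) = (a h != 0) && (x == phi h).
  rewrite mem_filter andb_idr // => /andP[+ _].
  by apply: contraNT => /Sa ->.
rewrite /push (@fsbigE _ _ _ _ _ r).
- rewrite big_seq_cond (eq_bigl (fun h => h \in r)) => [|h]; last first.
    by rewrite andb_idr // rP => /andP[ah /eqP xh]; apply/mem_set.
  rewrite -big_seq big_filter big_mkcond; apply: eq_bigr => h _.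
  have [->|ah] /= := eqVneq (a h) 0; first by rewrite mul0r.
  by case: eqP => _; rewrite ?mulr1 ?mulr0.
- by rewrite filter_uniq.
- by move=> h /=; rewrite rP => /andP[? /eqP ->].
- by move=> h [ah xh]; rewrite rP ah xh eqxx.
Qed.

Lemma push_fin_supp a : fin_supp (push phi a).
Proof.
apply: (@fin_supp_sub _ _ [fset phi h | h in gsupp a]%fset) => x xS.
rewrite (@push_big (gsupp a)) => [|h]; last exact: gsupp0.
rewrite big_seq big1 // => h hS; case: eqP => [xh|_]; last by rewrite mulr0.
by case/negP: xS; apply/imfsetP; exists h.
Qed.
Definition gpush a := GAlg (push_fin_supp a).

Lemma gpushE (S : {fset G}) a : (forall h, h \notin S -> a h = 0) ->
  gpush a = \sum_(h <- S) a h *: gdelta R (phi h).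
Proof.
move=> Sa; apply: galg_eq => x; rewrite [LHS](push_big x Sa) gval_sum.
by apply: eq_bigr => h _; rewrite gvalZ gdeltaE.
Qed.

Lemma gpushD a b : gpush (a + b) = gpush a + gpush b.
Proof.
pose S := (gsupp a `|` gsupp b)%fset.
have Sa h : h \notin S -> a h = 0 by rewrite in_fsetU negb_or => /andP[/gsupp0].
have Sb h : h \notin S -> b h = 0 by rewrite in_fsetU negb_or => /andP[_ /gsupp0].
rewrite !(@gpushE S) // => [|h hS]; last by rewrite gvalD Sa ?Sb ?addr0.
by rewrite -big_split; apply: eq_bigr => h _; rewrite gvalD scalerDl.
Qed.

Lemma gpushZ z a : gpush (z *: a) = z *: gpush a.
Proof.
rewrite !(@gpushE (gsupp a)) => [|h /gsupp0 //|h /gsupp0 ah]; last first.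
  by rewrite gvalZ ah mulr0.
by rewrite scaler_sumr; apply: eq_bigr => h _; rewrite gvalZ scalerA.
Qed.

Lemma gpush0 : gpush 0 = 0.
Proof. by rewrite (@gpushE fset0) // big_seq_fset0. Qed.

Lemma gpush_delta x : gpush (gdelta R x) = gdelta R (phi x).
Proof.
rewrite (@gpushE [fset x]%fset) => [|h]; last first.
  by rewrite in_fset1 gdeltaE => /negPf ->.
by rewrite big_seq_fset1 gdeltaE eqxx scale1r.
Qed.

Lemma gpush_supp a x : gpush a x != 0 -> exists2 h, a h != 0 & x = phi h.
Proof.
rewrite [gpush a x](@push_big (gsupp a)) => [ax|h]; last exact: gsupp0.
have [h hS xh] : exists2 h, h \in gsupp a & x == phi h.
  apply/hasP; apply: contraNT ax => /hasPn xS; rewrite big_seq big1 // => h /xS.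
  by move/negPf->; rewrite mulr0.
by exists h; [rewrite -in_gsupp | apply/eqP].
Qed.

Lemma gpush_val a h : injective phi -> gpush a (phi h) = a h.
Proof.
move=> phi_inj; rewrite [LHS](@push_big (gsupp a)) => [|k]; last exact: gsupp0.
rewrite [in RHS](galg_expand a) gval_sum; apply: eq_bigr => k _.
by rewrite gvalZ gdeltaE (inj_eq phi_inj).
Qed.

Hypothesis phiM : {morph phi : x y / (x * y)%g}.

Lemma morph_one : phi 1%g = 1%g.
Proof. by apply: (@mulgI _ (phi 1%g)); rewrite -phiM !mulg1. Qed.

Lemma morph_inv x : phi x^-1%g = (phi x)^-1%g.
Proof. by apply: (@mulgI _ (phi x)); rewrite -phiM !mulgV morph_one. Qed.

Lemma gpushM a b : gpush (a * b) = gpush a * gpush b.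
Proof.
elim/galg_ind: a => [|a1 a2 IH1 IH2|z a IH|x].
- by rewrite mul0r gpush0 mul0r.
- by rewrite mulrDl !gpushD IH1 IH2 mulrDl.
- by rewrite -scalerAl !gpushZ IH scalerAl.
elim/galg_ind: b => [|b1 b2 IH1 IH2|z b IH|y].
- by rewrite mulr0 gpush0 mulr0.
- by rewrite mulrDr !gpushD IH1 IH2 mulrDr.
- by rewrite -scalerAr !gpushZ IH scalerAr.
by rewrite gdeltaM !gpush_delta gdeltaM phiM.
Qed.

Lemma gpush_star a : gpush (star a) = star (gpush a).
Proof.
elim/galg_ind: a => [|a1 a2 IH1 IH2|z a IH|x].
- by rewrite star0 gpush0 star0.
- by rewrite starD !gpushD IH1 IH2 starD.
- by rewrite starZ !gpushZ IH starZ.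
by rewrite star_delta !gpush_delta star_delta morph_inv.
Qed.

End Push.

Section SquareNorm.
Local Open Scope classical_set_scope.
Variables (R : realType) (G : groupType).
Implicit Types (a b : galg R G) (xi eta : G -> R[i]).

Lemma conv_sum (I : Type) (r : seq I) (P : pred I) (F : I -> galg R G) xi g :
  conv (\sum_(i <- r | P i) F i) xi g = \sum_(i <- r | P i) conv (F i) xi g.
Proof.
by elim/big_rec2: _ => [|i x y _ <-]; rewrite ?conv0l // convD.
Qed.

Lemma conv_star1 a xi :
  conv (star a) xi 1%g = \sum_(h <- gsupp a) conjc (a h) * xi h.
Proof.
rewrite [in LHS](galg_expand a) star_sum conv_sum; apply: eq_bigr => h _.
by rewrite starZ star_delta convZ conv_delta_l invgK mulg1.
Qed.

Lemma sqnormc_ge0 (z : R[i]) : 0 <= sqnormc z.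
Proof. by rewrite addr_ge0 ?sqr_ge0. Qed.

Lemma sqnormcB (z w : R[i]) : sqnormc (w - z) =
  sqnormc w + (complex.Re (conjc z * z) - 2 * complex.Re (conjc z * w)).
Proof. by case: z w => [x y] [u v]; rewrite /sqnormc /=; ring. Qed.

(** The inner product with a finitely supported [a] is the value at 1 of [conv (star a) eta]. The
    correction is a finite number, so the expansion makes sense even when [l2sqnorm eta] is
    infinite; outside the support of [a] both sides have the same tail. *)
Lemma l2sqnormB a eta : l2sqnorm (fun g => eta g - a g) =
  (l2sqnorm eta + (complex.Re ((star a * a) 1%g)
                   - 2 * complex.Re (conv (star a) eta 1%g))%:E)%E.
Proof.
have split xi : l2sqnorm xi = ((\sum_(h <- gsupp a) sqnormc (xi h))%:E +
    esum (~` [set` gsupp a]) (fun g => (sqnormc (xi g))%:E))%E.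
  rewrite /l2sqnorm (esumID [set` gsupp a]) => [|g _]; last first.
    by rewrite lee_fin sqnormc_ge0.
  rewrite !setTI; congr (_ + _)%E; rewrite esum_fset //; last first.
    by move=> g _; rewrite lee_fin sqnormc_ge0.
  by rewrite -(fsbig_seq (GRing.add : Monoid.com_law _)) ?fset_uniq // ?sumEFin.
rewrite !split; set r := esum _ _; set r' := esum _ _.
have -> : r = r'.
  by apply: eq_esum => g /= /negP gS; rewrite (gsupp0 gS) subr0.
rewrite addeAC -EFinD; congr (_%:E + _)%E.
have ReM : {morph (@complex.Re R) : x y / x + y} by move=> [? ?] [? ?].
rewrite gvalM !conv_star1 !(big_morph _ ReM (erefl : complex.Re (0 : R[i]) = 0)).
rewrite mulr_sumr -sumrB -big_split; apply: eq_bigr => h _.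
exact: sqnormcB.
Qed.

Lemma l2sqnormN xi : l2sqnorm (fun g => - xi g) = l2sqnorm xi.
Proof. by apply: eq_esum => g _; rewrite /sqnormc !raddfN !sqrrN. Qed.

Lemma l2sqnorm0 : l2sqnorm (fun _ : G => 0 : R[i]) = 0%E.
Proof. by apply: esum1 => g _; rewrite /sqnormc expr0n addr0. Qed.

Lemma conv_0r a g : conv a (fun=> 0) g = 0.
Proof. by rewrite convE big1 // => h _; rewrite mulr0. Qed.

Lemma l2sqnorm_galg a : l2sqnorm a = (complex.Re ((star a * a) 1%g))%:E.
Proof.
rewrite -l2sqnormN; have := l2sqnormB a (fun=> 0).
rewrite l2sqnorm0 add0e conv_0r mulr0 subr0 => <-.
by apply: eq_esum => g _; rewrite sub0r.
Qed.

(** The trace of [star a * a] is the full square norm. This bound turns convergence of traces into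
    pointwise convergence. *)
Lemma sqnormc_le_tr a g : sqnormc (a g) <= complex.Re ((star a * a) 1%g).
Proof.
rewrite -lee_fin -l2sqnorm_galg; apply: esum_ge; exists [set g]; first by split.
by rewrite fsbig_set1.
Qed.

Lemma tr_star_ge0 a : 0 <= complex.Re ((star a * a) 1%g).
Proof. exact: le_trans (sqnormc_ge0 _) (sqnormc_le_tr a 1%g). Qed.

End SquareNorm.

(** * Projections onto kernels as limits in the group algebra *)

Section ComplexSequences.
Local Open Scope classical_set_scope.
Variable R : realType.
Implicit Types (u v : nat -> R[i]) (z w : R[i]).

(** Convergence is taken by real and imaginary parts, so that limit theorems for real sequences
    apply. *)
Definition ccvg u z :=
  ((fun n => complex.Re (u n)) @ \oo --> complex.Re z) /\
  ((fun n => complex.Im (u n)) @ \oo --> complex.Im z).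

Lemma ccvg_cst z : ccvg (fun=> z) z.
Proof. by split; exact: cvg_cst. Qed.

Lemma ccvgD u v z w : ccvg u z -> ccvg v w -> ccvg (fun n => u n + v n) (z + w).
Proof.
move=> [u1 u2] [v1 v2]; split; rewrite raddfD.
  by under eq_cvg do rewrite raddfD; exact: cvgD.
by under eq_cvg do rewrite raddfD; exact: cvgD.
Qed.

Lemma ccvgN u z : ccvg u z -> ccvg (fun n => - u n) (- z).
Proof.
move=> [u1 u2]; split; rewrite raddfN.
  by under eq_cvg do rewrite raddfN; exact: cvgN.
by under eq_cvg do rewrite raddfN; exact: cvgN.
Qed.

Lemma ReM (z w : R[i]) : complex.Re (z * w) =
  complex.Re z * complex.Re w - complex.Im z * complex.Im w.
Proof. by case: z w => [? ?] [? ?]. Qed.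

Lemma ImM (z w : R[i]) : complex.Im (z * w) =
  complex.Re z * complex.Im w + complex.Im z * complex.Re w.
Proof. by case: z w => [? ?] [? ?]. Qed.

Lemma ccvgZ w u z : ccvg u z -> ccvg (fun n => w * u n) (w * z).
Proof.
move=> [u1 u2]; split; rewrite ?ReM ?ImM.
  under eq_cvg do rewrite ReM.
  by apply: cvgB; apply: cvgM => //; exact: cvg_cst.
under eq_cvg do rewrite ImM.
by apply: cvgD; apply: cvgM => //; exact: cvg_cst.
Qed.

Lemma ccvg_sum (I : Type) (r : seq I) (F : I -> nat -> R[i]) (z : I -> R[i]) :
  (forall i, ccvg (F i) (z i)) ->
  ccvg (fun n => \sum_(i <- r) F i n) (\sum_(i <- r) z i).
Proof.
move=> Fz; elim: r => [|i r IHr].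
  by under eq_fun do rewrite big_nil; rewrite big_nil; exact: ccvg_cst.
under eq_fun do rewrite big_cons.
by rewrite big_cons; exact: ccvgD.
Qed.

Lemma ccvg_unique u z w : ccvg u z -> ccvg u w -> z = w.
Proof.
case: z w => [z1 z2] [w1 w2] [/= u1 u2] [/= v1 v2].
by congr Complex; [exact: (cvg_unique _ u1 v1)|exact: (cvg_unique _ u2 v2)].
Qed.

Lemma cvg_sqnormc u z : ccvg u z -> (fun n => sqnormc (u n)) @ \oo --> sqnormc z.
Proof. by move=> [u1 u2]; exact: (cvgD (cvgM u1 u1) (cvgM u2 u2)). Qed.

(** The tails [L - l N] tend to 0 and dominate the squared increments, so [u] is Cauchy. *)
Lemma cvg_of_sqr_le (u l : nat -> R) (L : R) : l @ \oo --> L ->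
  (forall N M, (N <= M)%N -> (u M - u N) ^+ 2 <= L - l N) -> cvg (u @ \oo).
Proof.
move=> lL ul; apply/cauchy_cvgP/cauchy_exP => eps eps0.
have e20 : 0 < eps ^+ 2 by rewrite exprn_gt0.
have /cvgrPdist_lt /(_ _ e20) [N _ lN] := lL.
exists (u N); exists N => // M /= NM; rewrite /ball /= distrC.
have uN := ul _ _ NM; have := lN N (leqnn N) => /= LN.
rewrite ltNge; apply/negP => eu.
have : eps ^+ 2 <= `|u M - u N| ^+ 2
  by apply: lerXn2r; rewrite ?nnegrE ?normr_ge0 ?(ltW eps0).
rewrite real_normK ?num_real // => eu2.
by have := le_lt_trans (le_trans eu2 uN) (le_lt_trans (ler_norm _) LN); rewrite ltxx.
Qed.

Lemma ccvg_of_sqnorm_le u (l : nat -> R) (L : R) : l @ \oo --> L ->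
  (forall N M, (N <= M)%N -> sqnormc (u M - u N) <= L - l N) ->
  exists z, ccvg u z.
Proof.
move=> lL ul.
have cre : cvg ((fun n => complex.Re (u n)) @ \oo).
  apply: (cvg_of_sqr_le lL) => N M /ul; rewrite /sqnormc !raddfB; apply: le_trans.
  by rewrite lerDl sqr_ge0.
have cim : cvg ((fun n => complex.Im (u n)) @ \oo).
  apply: (cvg_of_sqr_le lL) => N M /ul; rewrite /sqnormc !raddfB; apply: le_trans.
  by rewrite lerDr sqr_ge0.
by exists (Complex (lim ((fun n => complex.Re (u n)) @ \oo))
                   (lim ((fun n => complex.Im (u n)) @ \oo))).
Qed.

(** A form of Fatou's lemma: [esum] is a supremum over finite sets, and each finite sum passes to
    the limit. *)
Lemma l2sqnorm_lim (G : groupType) (x : nat -> G -> R[i]) xi (c : nat -> R) (d : R) :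
  (forall g, ccvg (fun n => x n g) (xi g)) -> c @ \oo --> d ->
  (forall n, (l2sqnorm (x n) <= (c n)%:E)%E) -> (l2sqnorm xi <= d%:E)%E.
Proof.
move=> xxi cd xc; apply: ge_ereal_sup => _ [A [fA _] <-].
have finE (y : G -> R[i]) : (\sum_(g \in A) (sqnormc (y g))%:E =
    (\sum_(g <- fset_set A) sqnormc (y g))%:E)%E.
  by rewrite fsbig_finite //= sumEFin.
rewrite finE lee_fin.
have cs : (fun n => \sum_(g <- fset_set A) sqnormc (x n g)) @ \oo -->
    \sum_(g <- fset_set A) sqnormc (xi g).
  elim: (enum_fset (fset_set A)) => [|g r IHr].
    by under eq_fun do rewrite big_nil; rewrite big_nil; exact: cvg_cst.
  under eq_fun do rewrite big_cons.
  by rewrite big_cons; apply: cvgD => //; exact: cvg_sqnormc.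
apply: (ler_cvg_to cs cd); apply: nearW => n; rewrite -lee_fin; apply: le_trans (xc n).
by apply: esum_ge; exists A => //; rewrite finE.
Qed.

End ComplexSequences.

Section ProjectionLimit.
Local Open Scope classical_set_scope.
Variables (R : realType) (G : groupType).
(** [P] is the increasing sequence of partial kernel projections and [Q] the part of the identity
    not yet exhausted. By [PQ] the rest has [Theta] as right factor, hence annihilates the
    kernel. *)
Variables (Theta : galg R G) (P Q B : nat -> galg R G) (L : R).
Hypothesis starP : forall N, star (P N) = P N.
Hypothesis PP : forall N M, (N <= M)%N -> P N * P M = P N.
Hypothesis ThetaP : forall N, Theta * P N = 0.
Hypothesis starQ : forall N, star (Q N) = Q N.
Hypothesis QQ : forall N, Q N * Q N = Q N.
Hypothesis PQ : forall N, 1 - P N - Q N = B N * Theta.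
Hypothesis trQ : (fun N => complex.Re (Q N 1%g)) @ \oo --> (0 : R).
Hypothesis trP : (fun N => complex.Re (P N 1%g)) @ \oo --> L.

Let p N := complex.Re (P N 1%g).
Let q N := complex.Re (Q N 1%g).

Let PP' N M : (N <= M)%N -> P M * P N = P N.
Proof. by move=> /PP /(congr1 (@star R G)); rewrite starM !starP. Qed.

Let trB N M : (N <= M)%N ->
  complex.Re ((star (P M - P N) * (P M - P N)) 1%g) = p M - p N.
Proof.
move=> NM; rewrite starD starN !starP mulrBl !mulrBr (PP NM) (PP' NM) !PP // subrr subr0.
by rewrite gvalB raddfB.
Qed.

Let p_le_L N : p N <= L.
Proof.
have cN : (fun _ : nat => p N) @ \oo --> p N by exact: cvg_cst.
apply: (ler_cvg_to cN trP); exists N => // M /= NM.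
by rewrite -subr_ge0 -(trB NM) tr_star_ge0.
Qed.

Let limP : {xi : G -> R[i] | forall g, ccvg (fun N => P N g) (xi g)}.
Proof.
apply: cid; suff /choice[xi xiP] : forall g, exists z, ccvg (fun N => P N g) z.
  by exists xi.
move=> g; apply: (ccvg_of_sqnorm_le trP) => N M NM.
rewrite -gvalB; apply: le_trans (sqnormc_le_tr _ _) _.
by rewrite trB // lerB.
Qed.

Lemma l2sqnorm_delta1B (xi : G -> R[i]) : (l2sqnorm (fun g => (delta R (1%g : G) g - xi g)%R) =
  l2sqnorm xi + (1 - 2 * complex.Re (xi 1%g))%:E)%E.
Proof.
rewrite -l2sqnormN.
have -> : (fun g => - (delta R (1%g : G) g - xi g)) = (fun g => xi g - (1 : galg R G) g).
  by apply: funext => g; rewrite opprB.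
by rewrite l2sqnormB star1 mul1r conv1 gval1 eqxx.
Qed.

(* For [eta] in the kernel, [eta = P N eta + Q N eta]; compare [eta] with
   [P N] and with [c * Q N], and let [N] then [c] go to infinity. *)
Lemma dist_ker_ge (eta : G -> R[i]) : l2ker Theta eta ->
  ((1 - L)%:E <= l2sqnorm (fun g => (delta R (1%g : G) g - eta g)%R))%E.
Proof.
move=> [l2eta Teta]; rewrite l2sqnorm_delta1B.
have l2eta0 : (0 <= l2sqnorm eta)%E.
  by apply: esum_ge0 => g _; rewrite lee_fin sqnormc_ge0.
have : l2sqnorm eta \is a fin_num by rewrite ge0_fin_numE.
case er : (l2sqnorm eta) l2eta0 => [r||] // r0 _; rewrite lee_fin in r0.
rewrite -EFinD lee_fin.
have etaE N : eta 1%g = conv (P N) eta 1%g + conv (Q N) eta 1%g.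
  have BT : conv (B N * Theta) eta 1%g = 0.
    by rewrite (convM (B N) Theta eta) Teta; exact: conv_0r.
  have : 1 = P N + Q N + B N * Theta by rewrite -PQ -[1 - _ - _]addrA -opprD [RHS]addrC subrK.
  move/(congr1 (fun a : galg R G => conv a eta 1%g)).
  by rewrite conv1 (convD (P N + Q N)) BT addr0 (convD (P N)).
have sq_ge0 a : 0 <= r + (complex.Re ((star a * a) 1%g)
                   - 2 * complex.Re (conv (star a) eta 1%g)).
  rewrite -lee_fin EFinD -er -l2sqnormB.
  by apply: esum_ge0 => g _; rewrite lee_fin sqnormc_ge0.
(* Dividing $\|\eta-cQ_N\|^2\ge0$ by $c$ gives $2\,\mathrm{Re}(Q_N\eta)(1)\le r/c+c\,q_N$, whose
   last term vanishes in the limit for fixed [c]. *)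
have bound (c : R) N : 0 < c ->
    1 - L <= r + (1 - 2 * complex.Re (eta 1%g)) + c^-1 * r + c * q N.
  move=> c0; have := sq_ge0 (P N); rewrite starP PP // => hP.
  have := sq_ge0 ((c%:C)%C *: Q N).
  rewrite starZ starQ conjc_real -scalerAl -scalerAr QQ !gvalZ convZ.
  have RecM x : complex.Re ((c%:C)%C * x) = c * complex.Re x.
    by rewrite ReM /= mul0r subr0.
  rewrite !RecM => hQ; have := p_le_L N; rewrite (etaE N) raddfD -/(p N) -/(q N) in hP hQ *.
  set x := complex.Re _ in hP *; set y := complex.Re _ in hQ * => pL.
  have hQ' : 0 <= c^-1 * r + c * q N - 2 * y.
    have -> : c^-1 * r + c * q N - 2 * y = c^-1 * (r + (c * (c * q N) - 2 * (c * y))).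
      by field; rewrite gt_eqF.
    by rewrite mulr_ge0 // invr_ge0 ltW.
  lra.
have {}bound (c : R) : 0 < c -> 1 - L <= r + (1 - 2 * complex.Re (eta 1%g)) + c^-1 * r.
  move=> c0; pose b N := r + (1 - 2 * complex.Re (eta 1%g)) + c^-1 * r + c * q N.
  have cb : b @ \oo --> r + (1 - 2 * complex.Re (eta 1%g)) + c^-1 * r + c * 0.
    apply: cvgD; first exact: cvg_cst.
    by apply: cvgM => //; exact: cvg_cst.
  rewrite mulr0 addr0 in cb.
  have cL : (fun _ : nat => 1 - L) @ \oo --> 1 - L by exact: cvg_cst.
  by apply: (ler_cvg_to cL cb); apply: nearW => N; exact: bound.
apply/ler_addgt0Pr => eps eps0.
(* This value makes the error [c^-1 * r] equal to [eps * r / (r + 1)]; the summand 1 covers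
   [r = 0]. *)
have c0 : 0 < (r + 1) / eps by rewrite divr_gt0 // ltr_wpDl.
apply: le_trans (bound _ c0) _; rewrite lerD2l invf_div mulrAC ler_pdivrMr ?ltr_wpDl //.
by rewrite ler_pM2l // lerDl.
Qed.

(** The limit of [P N] exists pointwise because the squared increments are at most [L - p N]. From
    $\|\delta_1-P_N\|^2=1-p_N$ its distance to $\delta_1$ has square at most [1 - L], the lower
    bound valid on the whole kernel. The kernel equation passes to the limit because [Theta] has
    finite support. *)
Lemma orth_proj_limit : exists xi : G -> R[i],
  is_orth_proj (l2ker Theta) (delta R (1%g : G)) xi /\ xi 1%g = (L%:C)%C.
Proof.
have [xi xiP] := limP; exists xi.
have P1N N : complex.Im (P N 1%g) = 0.
  have := congr1 (fun a : galg R G => complex.Im (a 1%g)) (starP N).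
  by rewrite gval_star invg1; case: (P N 1%g) => [x y] /= yN; lra.
have xi1 : xi 1%g = (L%:C)%C.
  apply: (ccvg_unique (xiP _)); split => //=.
  by under eq_fun do rewrite P1N; exact: cvg_cst.
have PNorm N : l2sqnorm (P N) = (p N)%:E by rewrite l2sqnorm_galg starP PP.
split=> //; split; last first.
  move=> eta /dist_ker_ge; apply: le_trans.
  apply: (@l2sqnorm_lim _ _ (fun N g => delta R (1%g : G) g - P N g) _ (fun N => 1 - p N)).
  - by move=> g; apply: ccvgD; [exact: ccvg_cst | exact: ccvgN].
  - by apply: cvgB => //; exact: cvg_cst.
  - by move=> N; rewrite l2sqnorm_delta1B PNorm -EFinD lee_fin /p; lra.
split.
  apply: le_lt_trans (ltry L).
  by apply: (l2sqnorm_lim xiP trP) => N; rewrite PNorm.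
apply: funext => g; rewrite convE.
have cT : ccvg (fun N => (Theta * P N) g) (\sum_(h <- gsupp Theta) Theta h * xi (h^-1 * g)%g).
  under eq_fun do rewrite gvalM convE.
  by apply: ccvg_sum => h; exact: ccvgZ.
apply: (ccvg_unique cT); under eq_fun do rewrite ThetaP gval0; exact: ccvg_cst.
Qed.

End ProjectionLimit.

(** * Intertwiners of path matrices *)

Section PathMatrices.
Variable F : fieldType.

Definition path_mx n : 'M[F]_n := \matrix_(i, j) ((i.+1 == j) || (j.+1 == i))%:R.

Lemma path_mx_sym n (i j : 'I_n) : path_mx n i j = path_mx n j i.
Proof. by rewrite !mxE orbC. Qed.

(** The Chebyshev polynomial of the second kind $U_{k-1}(A/2)$. The shifted index, with value 0 at
    [k = 0], gives the divisibility pattern of Fibonacci numbers. *)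
Fixpoint cheb n (A : 'M[F]_n) k {struct k} : 'M[F]_n :=
  if k is k1.+1 then if k1 is k2.+1 then A *m cheb A k1 - cheb A k2 else 1%:M else 0.

Lemma chebSS n (A : 'M[F]_n) k : cheb A k.+2 = A *m cheb A k.+1 - cheb A k.
Proof. by []. Qed.

Lemma cheb_comm n (A : 'M[F]_n) k : A *m cheb A k = cheb A k *m A.
Proof.
suff [//] : A *m cheb A k = cheb A k *m A /\ A *m cheb A k.+1 = cheb A k.+1 *m A.
elim: k => [|k [IH1 IH2]]; first by rewrite /= mulmx0 mul0mx mulmx1 mul1mx.
by split=> //; rewrite chebSS mulmxBr mulmxBl IH1 {1}IH2 mulmxA.
Qed.

(** The counterpart of the addition formula for Fibonacci numbers. *)
Lemma cheb_add n (A : 'M[F]_n) a b :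
  cheb A (a + b).+1 = cheb A a.+1 *m cheb A b.+1 - cheb A a *m cheb A b.
Proof.
elim: a b => [|a IHa] b; first by rewrite add0n mul1mx mul0mx subr0.
rewrite addSnnS IHa chebSS mulmxBr mulmxA -cheb_comm chebSS mulmxBl.
by rewrite addrAC.
Qed.

Lemma cheb_comm2 n (A : 'M[F]_n) a b : cheb A a *m cheb A b = cheb A b *m cheb A a.
Proof.
suff [//] : cheb A a *m cheb A b = cheb A b *m cheb A a /\
  cheb A a.+1 *m cheb A b = cheb A b *m cheb A a.+1.
elim: a => [|a [IH1 IH2]]; first by rewrite /= mul0mx mulmx0 mul1mx mulmx1.
split=> //; rewrite chebSS mulmxBr mulmxBl IH1 -[in LHS]mulmxA IH2.
by rewrite !mulmxA (cheb_comm A b).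
Qed.

(** Cassini's identity for this recursion. Where [cheb A n.+1] vanishes, it exhibits an inverse of
    [cheb A n]. *)
Lemma cheb_det n (A : 'M[F]_n) k :
  cheb A k.+1 *m cheb A k.+1 - cheb A k *m cheb A k.+2 = 1%:M.
Proof.
elim: k => [|k IHk]; first by rewrite /= mulmx1 mul0mx subr0.
move: (cheb A k.+3) (cheb A k.+2) (cheb A k.+1) (cheb A k) IHk (chebSS A k.+1)
  (chebSS A k) (cheb_comm A k.+1) => s3 s2 s1 s0 <- -> e2 c.
rewrite mulmxBr mulmxA -c {1}e2 mulmxBl opprB addrC addrA subrK.
by [].
Qed.

(* The [k]-th basis row vector, counted from 1; it is 0 for k = 0 and k > n. *)
Definition vrow n k : 'rV[F]_n := \row_j (k == j.+1)%:R.

Lemma vrow_row n (i : 'I_n) : vrow n i.+1 = delta_mx 0 i.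
Proof. by apply/rowP => j; rewrite !mxE /= eqSS eq_sym. Qed.

Lemma vrow0 n : vrow n 0 = 0.
Proof. by apply/rowP => j; rewrite !mxE. Qed.

Lemma vrow_last n : vrow n n.+1 = 0.
Proof. by apply/rowP => j; rewrite !mxE eqSS gtn_eqF. Qed.

Lemma vrow_mul n q (W : 'M[F]_(n, q)) (i : 'I_n) : vrow n i.+1 *m W = row i W.
Proof. by rewrite vrow_row -rowE. Qed.

Lemma vrow_path n k : (k < n)%N ->
  vrow n k.+1 *m path_mx n = vrow n k + vrow n k.+2.
Proof.
move=> kn; rewrite -[k]/(nat_of_ord (Ordinal kn)) vrow_mul.
apply/rowP => j; rewrite !mxE /= !eqSS [X in (_ || X)]eq_sym.
have [->|] := eqVneq k j.+1; last by rewrite orbF add0r.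
by rewrite orbT (@gtn_eqF j j.+2) ?addr0 //; lia.
Qed.

Lemma vrow_inj n q (W Z : 'M[F]_(n, q)) :
  (forall k, (k < n)%N -> vrow n k.+1 *m W = vrow n k.+1 *m Z) -> W = Z.
Proof. by move=> WZ; apply/row_matrixP => i; rewrite -!vrow_mul WZ. Qed.

(** The rows of an intertwiner satisfy the three-term recursion of [cheb], starting from row 0,
    which is zero. The range includes [k = m.+1], where the left side is zero: this is the boundary
    condition. *)
Lemma path_rec m n (W : 'M[F]_(m, n)) : path_mx m *m W = W *m path_mx n ->
  forall k, (k <= m.+1)%N -> vrow m k *m W = vrow m 1 *m W *m cheb (path_mx n) k.
Proof.
move=> AW k; suff H : ((k <= m.+1)%N ->
    vrow m k *m W = vrow m 1 *m W *m cheb (path_mx n) k) /\ ((k.+1 <= m.+1)%N ->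
    vrow m k.+1 *m W = vrow m 1 *m W *m cheb (path_mx n) k.+1) by case: H.
elim: k => [|k [IH1 IH2]].
  by rewrite /= vrow0 mul0mx mulmx0 mulmx1.
split=> // km.
have : vrow m k.+1 *m path_mx m *m W = vrow m k *m W + vrow m k.+2 *m W.
  by rewrite vrow_path // mulmxDl.
rewrite -mulmxA AW mulmxA IH1 ?IH2; try lia.
move=> /(canLR (addKr _)) <-.
by rewrite chebSS mulmxBr cheb_comm mulmxA addrC.
Qed.

(** Cayley-Hamilton for the path. With $C_k$ for [cheb (path_mx n) k] and $v_k$ for [vrow n k], the
    intertwiner 1 gives $v_k=v_1C_k$, whence $v_kC_{n+1}=v_1C_{n+1}C_k=v_{n+1}C_k=0$. *)
Lemma cheb_path n : cheb (path_mx n) n.+1 = 0.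
Proof.
have rec := @path_rec n n 1%:M (etrans (mulmx1 _) (esym (mul1mx _))).
apply: vrow_inj => k kn; rewrite mulmx0 -[vrow n k.+1]mulmx1 rec; last lia.
rewrite -mulmxA cheb_comm2 mulmxA -rec // vrow_last !mul0mx //.
Qed.

Lemma cheb_path_unit n : cheb (path_mx n) n \in unitmx.
Proof.
have := cheb_det (path_mx n) n; rewrite cheb_path mulmx0 sub0r -mulmxN.
by case/mulmx1_unit.
Qed.

Definition twine m n (W : 'M[F]_(m, n)) := path_mx m *m W - W *m path_mx n.

Lemma twine_is_linear m n : linear (@twine m n).
Proof.
move=> a V W; rewrite /twine mulmxDr mulmxDl -scalemxAr -scalemxAl scalerBr.
by rewrite opprD addrACA.
Qed.
HB.instance Definition _ m n := GRing.isLinear.Build F 'M[F]_(m, n) 'M[F]_(m, n) _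
  (@twine m n) (@twine_is_linear m n).

Definition twine_mx m n : 'M[F]_(m * n) := lin_mx (@twine m n).

Lemma sub_ker_twine m n (W : 'M[F]_(m, n)) :
  (mxvec W <= kermx (twine_mx m n))%MS = (path_mx m *m W == W *m path_mx n).
Proof.
by rewrite sub_kermx mul_vec_lin mxvec_eq0 /twine subr_eq0.
Qed.

(* An intertwiner [W] is determined by its first row [v], its [k]-th row being
   [v *m cheb (path_mx n) k]; the boundary condition is the vanishing of row [m + 1]. *)
Lemma rank_ker_twine m n :
  \rank (kermx (twine_mx m n)) = \rank (kermx (cheb (path_mx n) m.+1)).
Proof.
pose E := lin1_mx (mulmx (vrow m 1) \o (@vec_mx F m n)).
have EW W : mxvec W *m E = vrow m 1 *m W by rewrite mul_rV_lin1 /= mxvecK.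
have capE : (kermx (twine_mx m n) :&: kermx E)%MS = 0.
  apply/eqP; rewrite -submx0; apply/rV_subP => w.
  rewrite sub_capmx -(vec_mxK w) sub_ker_twine => /andP[/eqP AW].
  rewrite sub_kermx EW => /eqP W1; rewrite submx0; apply/eqP.
  rewrite (_ : vec_mx w = 0) ?linear0 //; apply: vrow_inj => k km.
  by rewrite (path_rec AW) ?W1 ?mul0mx ?mulmx0 //; lia.
have kE : (kermx (twine_mx m n) *m E :=: kermx (cheb (path_mx n) m.+1))%MS.
  apply/eqmxP/andP; split; apply/rV_subP => v.
    case/submxP => x ->; rewrite mulmxA.
    have : (x *m kermx (twine_mx m n) <= kermx (twine_mx m n))%MS by exact: submxMl.
    move: (x *m _) => w; rewrite -(vec_mxK w) sub_ker_twine EW => /eqP AW.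
    by rewrite sub_kermx -(path_rec AW) // vrow_last mul0mx.
  rewrite sub_kermx => /eqP v0.
  pose W : 'M_(m, n) := \matrix_(i < m) (v *m cheb (path_mx n) i.+1).
  have WE k : (k <= m.+1)%N -> vrow m k *m W = v *m cheb (path_mx n) k.
    case: k => [|k km]; first by rewrite vrow0 mul0mx mulmx0.
    have [kltm|] := ltnP k m.
      by rewrite -[k]/(nat_of_ord (Ordinal kltm)) vrow_mul rowK.
    move=> mk; have -> : k = m by lia.
    by rewrite vrow_last mul0mx v0.
  have -> : v = mxvec W *m E by rewrite EW WE // mulmx1.
  apply: submxMr; rewrite sub_ker_twine; apply/eqP/vrow_inj => k km.
  rewrite mulmxA vrow_path // mulmxDl !mulmxA !WE; try lia.
  rewrite -mulmxDr -mulmxA -cheb_comm; congr (_ *m _).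
  by rewrite chebSS addrC subrK.
by rewrite -kE -(mxrank_mul_ker (kermx (twine_mx m n)) E) capE mxrank0 addn0.
Qed.

Lemma twine_mxE m n (i k : 'I_m) (j l : 'I_n) :
  twine_mx m n (mxvec_index i j) (mxvec_index k l) =
  path_mx m k i * (l == j)%:R - (k == i)%:R * path_mx n l j.
Proof.
have -> : twine_mx m n (mxvec_index i j) (mxvec_index k l) =
    row (mxvec_index i j) (twine_mx m n) 0 (mxvec_index k l) by rewrite [in RHS]mxE.
have dE := esym (@mxvec_delta F m n i j).
rewrite rowE dE mul_vec_lin mxvecE /= /twine.
have l1 : (path_mx m *m delta_mx i j) k l = path_mx m k i * (l == j)%:R.
  rewrite mxE (bigD1 i) //= big1 => [|a /negPf ai].
    by rewrite addr0 [delta_mx _ _ _ _]mxE eqxx.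
  by rewrite [delta_mx _ _ _ _]mxE ai mulr0.
have l2 : (delta_mx i j *m path_mx n) k l = (k == i)%:R * path_mx n j l.
  rewrite mxE (bigD1 j) //= big1 => [|a /negPf aj].
    by rewrite addr0 [delta_mx _ _ _ _]mxE eqxx andbT.
  by rewrite [delta_mx _ _ _ _]mxE aj andbF mul0r.
by rewrite [LHS]mxE [X in _ + X]mxE l1 l2; congr (_ - _ * _); exact: path_mx_sym.
Qed.

Lemma twine_mx_sym m n : (twine_mx m n)^T = twine_mx m n.
Proof.
apply/matrixP => x y; rewrite mxE; case/mxvec_indexP: x => i j.
case/mxvec_indexP: y => k l; rewrite !twine_mxE.
by rewrite (path_mx_sym k) (path_mx_sym l) (eq_sym k) (eq_sym l).
Qed.

(** Path matrices are symmetric, so transposition embeds the intertwiners of one direction into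
    those of the other. *)
Lemma rank_ker_twine_le m n :
  (\rank (kermx (twine_mx m n)) <= \rank (kermx (twine_mx n m)))%N.
Proof.
pose T p q := lin_mx (@trmx F p q).
have TE p q (W : 'M_(p, q)) : mxvec W *m T p q = mxvec W^T by rewrite mul_vec_lin.
have free_T : row_free (T m n).
  rewrite -kermx_eq0 -submx0; apply/rV_subP => w; rewrite sub_kermx submx0.
  by rewrite -(vec_mxK w) TE !mxvec_eq0 trmx_eq0.
rewrite -(mxrankMfree _ free_T); apply/mxrankS/rV_subP => w /submxP[x ->].
rewrite mulmxA; have := submxMl x (kermx (twine_mx m n)).
move: (x *m _) => v; rewrite -(vec_mxK v) TE !sub_ker_twine => /eqP /(congr1 trmx).
have sym p : (path_mx p)^T = path_mx p.
  by apply/matrixP => i j; rewrite mxE path_mx_sym.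
by rewrite !trmx_mul !sym => ->.
Qed.

Lemma rank_ker_cheb_sym m n :
  \rank (kermx (cheb (path_mx n) m.+1)) = \rank (kermx (cheb (path_mx m) n.+1)).
Proof.
rewrite -(rank_ker_twine m n) -(rank_ker_twine n m).
by apply/eqP; rewrite eqn_leq !rank_ker_twine_le.
Qed.

(** Since $C_{n+1}=0$, the addition formula leaves $C_{M+n+1}=-C_MC_n$, and $C_n$ is invertible. *)
Lemma rank_ker_cheb_shift M n : \rank (kermx (cheb (path_mx n) (M + n.+1))) =
  \rank (kermx (cheb (path_mx n) M)).
Proof.
rewrite !mxrank_ker addnS cheb_add cheb_path mulmx0 sub0r mxrank_opp.
by rewrite mxrankMfree // row_free_unit cheb_path_unit.
Qed.

(* Euclid's algorithm: [cheb_path] shifts the index by [n + 1], and transposing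
   intertwiners exchanges the two arguments. *)
Lemma rank_ker_cheb M n : \rank (kermx (cheb (path_mx n) M)) = (gcdn M n.+1).-1.
Proof.
have [k] := ubnP (M + n); elim: k M n => // k IHk M n Mn.
(* At index 0 the matrix is 0, and its kernel has dimension $n=\gcd(0,n+1)-1$. *)
case: M Mn => [|m] Mn; first by rewrite gcd0n mxrank_ker mxrank0 subn0.
have [nm|mn] := leqP n m.
  rewrite -[X in cheb _ X](@subnK n.+1) // rank_ker_cheb_shift IHk; last lia.
  by rewrite [in LHS]gcdnC [in RHS]gcdnC -[in RHS](@subnK n.+1 m.+1) // gcdnDr.
rewrite rank_ker_cheb_sym -[X in cheb _ X](@subnK m.+1); last lia.
rewrite rank_ker_cheb_shift IHk; last lia.
by rewrite [in LHS]gcdnC -[in RHS](@subnK m.+1 n.+1) ?gcdnDr //; lia.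
Qed.

End PathMatrices.

(** * Orthogonal projection onto the kernel of a symmetric matrix *)

Section KernelProjection.
Variable F : realFieldType.

Lemma row_sqr_eq0 n (x : 'rV[F]_n) : x *m x^T = 0 -> x = 0.
Proof.
move=> /matrixP /(_ 0 0); rewrite !mxE => x0; apply/rowP => j; rewrite mxE.
have /eqP : x 0 j * x^T j 0 = 0.
  by apply: (psumr_eq0P _ x0) => // i _; rewrite mxE -expr2 sqr_ge0.
by rewrite mxE mulf_eq0 orbb => /eqP.
Qed.

(** In a full-rank factorisation of an idempotent, the factors multiplied in the other order give
    the identity of size the rank. *)
Lemma idempotent_trace n (P : 'M[F]_n) : P *m P = P -> \tr P = (\rank P)%:R.
Proof.
move=> PP; have PE := mulmx_base P.
have : row_base P *m col_base P = 1%:M.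
  apply: (row_free_inj (row_base_free P)); apply: (row_full_inj (col_base_full P)).
  rewrite /= mul1mx mulmxA [col_base P *m (_ *m _)]mulmxA PE -mulmxA PE.
  by [].
by move=> rc; rewrite -(congr1 mxtrace PE) mxtrace_mulC rc mxtrace1.
Qed.

(* [H] and [H^2] have the same row space since [x H H^T x^T = 0] forces [x H = 0]. *)
Lemma sym_ker_proj n (H : 'M[F]_n) : H^T = H -> exists2 C : 'M[F]_n,
  [/\ (C *m H)^T = C *m H, C *m H *m (C *m H) = C *m H & H *m (C *m H) = H] &
  \tr (1%:M - C *m H) = (\rank (kermx H))%:R.
Proof.
move=> symH.
have : (H <= H *m H)%MS.
  have [_ <-] := mxrank_leqif_sup (submxMl H H).
  have := mxrank_mul_ker H H; rewrite (_ : (_ :&: _)%MS = 0) ?mxrank0 ?addn0 => [->//|].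
  apply/eqP; rewrite -submx0; apply/rV_subP => w; rewrite sub_capmx sub_kermx submx0.
  case/andP => /submxP[y ->] /eqP yHH; apply/eqP/row_sqr_eq0.
  by rewrite trmx_mul symH mulmxA yHH mul0mx.
(* [H = C H H] means that [Q = C H] fixes [H] from the left; this alone forces [Q] to be symmetric,
   then idempotent. Having [H] as right factor of [Q] is what later produces [Theta] as right
   factor. *)
case/submxP => C HE; pose Q := C *m H.
have QH : Q *m H = H by rewrite /Q -mulmxA -HE.
have HQt : H *m Q^T = H by have := congr1 trmx QH; rewrite trmx_mul symH.
have QQt : Q *m Q^T = Q by rewrite {1}/Q -mulmxA HQt.
have symQ : Q^T = Q by rewrite -{1}QQt trmx_mul trmxK.
have HQ : H *m Q = H by rewrite -{1}symQ.
have QQ : Q *m Q = Q by rewrite {1}/Q -mulmxA HQ.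
exists C; rewrite -/Q; first by [].
rewrite idempotent_trace; last first.
  by rewrite mulmxBr mulmx1 mulmxBl mul1mx QQ subrr subr0.
congr (_%:R); apply/eqP; rewrite eqn_leq !mxrankS //.
  by apply/rV_subP => w; rewrite sub_kermx => /eqP wH; apply/submxP; exists w;
    rewrite mulmxBr mulmx1 -symQ trmx_mul symH mulmxA wH mul0mx subr0.
by rewrite sub_kermx mulmxBl mul1mx QH subrr.
Qed.

End KernelProjection.

(** * Blocks of matrix units *)

Section MatrixUnits.
Variables (R : realType) (G : groupType).

(** Matrix units extended linearly to real matrices; with real coefficients transposition
    corresponds to [star]. *)
Definition mxrep N (U : 'I_N -> 'I_N -> galg R G) (M : 'M[R]_N) : galg R G :=
  \sum_x \sum_y (M x y)%:C%C *: U x y.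

Lemma mxrep_orth N N' (U : 'I_N -> 'I_N -> galg R G) (V : 'I_N' -> 'I_N' -> galg R G) M K :
  (forall x y z w, U x y * V z w = 0) -> mxrep U M * mxrep V K = 0.
Proof.
move=> UV; rewrite /mxrep mulr_suml big1 // => x _; rewrite mulr_suml big1 // => y _.
rewrite mulr_sumr big1 // => z _; rewrite mulr_sumr big1 // => w _.
by rewrite -scalerAl -scalerAr UV !scaler0.
Qed.

Variables (N : nat) (U : 'I_N -> 'I_N -> galg R G).
Hypothesis UM : forall x y z w, U x y * U z w = if y == z then U x w else 0.
Hypothesis starU : forall x y, star (U x y) = U y x.
Implicit Types M K : 'M[R]_N.

Lemma mxrepB M K : mxrep U (M - K) = mxrep U M - mxrep U K.
Proof.
rewrite /mxrep -sumrB; apply: eq_bigr => x _; rewrite -sumrB; apply: eq_bigr => y _.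
by rewrite !mxE rmorphB scalerBl.
Qed.

Lemma mxrepM M K : mxrep U M * mxrep U K = mxrep U (M *m K).
Proof.
rewrite /mxrep mulr_suml; apply: eq_bigr => x _.
under [RHS]eq_bigr => w _ do rewrite mxE rmorph_sum scaler_suml.
rewrite [RHS]exchange_big mulr_suml; apply: eq_bigr => y _ /=.
rewrite mulr_sumr (bigD1 y) //= [X in _ + X]big1 ?addr0 => [|z /negPf zy]; last first.
  rewrite mulr_sumr big1 // => w _.
  by rewrite -scalerAl -scalerAr UM eq_sym zy !scaler0.
rewrite mulr_sumr; apply: eq_bigr => w _.
by rewrite -scalerAl -scalerAr UM eqxx scalerA rmorphM.
Qed.

Lemma star_mxrep M : star (mxrep U M) = mxrep U M^T.
Proof.
rewrite /mxrep star_sum [RHS]exchange_big; apply: eq_bigr => x _.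
rewrite star_sum; apply: eq_bigr => y _.
by rewrite starZ starU conjc_real mxE.
Qed.

Variables (Theta : galg R G) (H : 'M[R]_N) (c : R).
Hypothesis starTheta : star Theta = Theta.
Hypothesis symH : H^T = H.
Hypothesis ThetaU : forall x y, Theta * U x y = \sum_z (H z x)%:C%C *: U z y.
Hypothesis trU : forall x y, U x y 1%g = if x == y then c%:C%C else 0.

Lemma Theta_mxrep M : Theta * mxrep U M = mxrep U (H *m M).
Proof.
rewrite /mxrep mulr_sumr; under eq_bigr => x _ do rewrite mulr_sumr.
rewrite exchange_big [RHS]exchange_big; apply: eq_bigr => y _ /=.
under [RHS]eq_bigr => z _ do rewrite mxE rmorph_sum scaler_suml.
rewrite [RHS]exchange_big; apply: eq_bigr => x _ /=.
rewrite -scalerAr ThetaU scaler_sumr; apply: eq_bigr => z _.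
by rewrite scalerA rmorphM mulrC.
Qed.

Lemma tr_mxrep M : mxrep U M 1%g = (\tr M * c)%:C%C.
Proof.
rewrite /mxrep gval_sum mulr_suml rmorph_sum; apply: eq_bigr => x _.
rewrite gval_sum (eq_bigr (fun y => if y == x then (M x x * c)%:C%C else 0)).
  by rewrite -big_mkcond big_pred1_eq.
move=> y _; rewrite gvalZ trU (eq_sym y); case: eqP => [->|_]; last by rewrite mulr0.
by rewrite rmorphM.
Qed.

(** The projection [1 - C H] onto the kernel of [H] is carried into the block. Its complement [C H]
    becomes [B * Theta], the form that acts as zero on kernel vectors in $l^2(G)$. *)
Lemma block_kernel : exists P B : galg R G,
  [/\ star P = P, P * P = P, Theta * P = 0, mxrep U 1%:M - P = B * Theta &
    P 1%g = ((\rank (kermx H))%:R * c)%:C%C /\ exists M, P = mxrep U M].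
Proof.
have [C [symQ QQ HQ] trQ] := sym_ker_proj symH.
exists (mxrep U (1%:M - C *m H)), (mxrep U C * mxrep U 1%:M); split.
- by rewrite star_mxrep linearB /= trmx1 symQ.
- by rewrite mxrepM mulmxBr mulmx1 mulmxBl mul1mx QQ subrr subr0.
- rewrite Theta_mxrep mulmxBr mulmx1 HQ subrr /mxrep big1 // => x _.
  by rewrite big1 // => y _; rewrite mxE scale0r.
- rewrite mxrepB opprB addrC subrK -mxrepM.
  (* [ThetaU] describes [Theta] acting from the left; taking stars moves it to the right. *)
  have -> : mxrep U H = star (Theta * mxrep U 1%:M).
    by rewrite Theta_mxrep mulmx1 star_mxrep symH.
  by rewrite starM star_mxrep trmx1 starTheta mulrA.
- by rewrite tr_mxrep trQ; split=> //; exists (1%:M - C *m H).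
Qed.

End MatrixUnits.

Section SquareSums.
Variables (R : realType) (G : groupType).
Implicit Types X Y : nat -> nat -> galg R G.

Definition square_sum X N := \sum_(m < N) \sum_(n < N) X m n.

Lemma square_sumM X N M : (N <= M)%N ->
  (forall m n m' n', X m n * X m' n' = if (m == m') && (n == n') then X m n else 0) ->
  square_sum X N * square_sum X M = square_sum X N.
Proof.
move=> NM XX; rewrite /square_sum mulr_suml; apply: eq_bigr => m _.
rewrite mulr_suml; apply: eq_bigr => n _; rewrite mulr_sumr.
rewrite (eq_bigr (fun m' : 'I_M => if m' == widen_ord NM m then X m n else 0)).
  by rewrite -big_mkcond big_pred1_eq.
move=> m' _; rewrite mulr_sumr.
rewrite (eq_bigr (fun n' : 'I_M => if n' == widen_ord NM n then
    if m' == widen_ord NM m then X m n else 0 else 0)).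
  by rewrite -big_mkcond big_pred1_eq.
move=> n' _; rewrite XX -!val_eqE /= (eq_sym (m : nat)) (eq_sym (n : nat)).
by do 2!case: eqP.
Qed.

End SquareSums.

(** * Products of two families of path blocks *)

Section PathUnits.
Variables (R : realType) (G : groupType).

(* [E m i j], for [i, j <= m], are the matrix units of a block on which [T] acts
   as the adjacency operator of a path with [m + 1] vertices. *)
Record path_units (T : galg R G) (E : forall m, 'I_m.+1 -> 'I_m.+1 -> galg R G) : Prop := {
  pu_mul : forall m (i j k l : 'I_m.+1), E m i j * E m k l = if j == k then E m i l else 0;
  pu_orth : forall m n (i j : 'I_m.+1) (k l : 'I_n.+1), m != n -> E m i j * E n k l = 0;
  pu_star : forall m (i j : 'I_m.+1), star (E m i j) = E m j i;
  pu_act : forall m (i j : 'I_m.+1),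
    T * E m i j = \sum_(k < m.+1) (path_mx R m.+1 k i)%:C%C *: E m k j;
  pu_self : star T = T }.

Variables (T S : galg R G) (E F : forall m, 'I_m.+1 -> 'I_m.+1 -> galg R G).
Variables (w v : nat -> R) (L : R).
Hypotheses (puE : path_units T E) (puF : path_units S F).
Hypothesis EF : forall m (i j : 'I_m.+1) n (k l : 'I_n.+1), E i j * F k l = F k l * E i j.
Hypothesis SE : forall m (i j : 'I_m.+1), S * E i j = E i j * S.
Hypothesis trEF : forall m (i j : 'I_m.+1) n (k l : 'I_n.+1),
  (E i j * F k l) 1%g = if (i == j) && (k == l) then (w m * v n)%:C%C else 0.

(** The inverse of [mxvec_index]. Indexing a product block by positions in a vectorised matrix lets
    [twine_mx] serve as the matrix of [T - S]. *)
Definition unindex m n (x : 'I_(m * n)) : 'I_m * 'I_n :=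
  enum_val (cast_ord (esym (mxvec_cast m n)) x).

Lemma mxvec_indexK m n i j : unindex (@mxvec_index m n i j) = (i, j).
Proof. by rewrite /unindex /mxvec_index cast_ordK enum_rankK. Qed.

Lemma unindex_inj m n : injective (@unindex m n).
Proof. by move=> x y /enum_val_inj /cast_ord_inj. Qed.

Lemma unindex_eq m n (x y : 'I_(m * n)) :
  (x == y) = ((unindex x).1 == (unindex y).1) && ((unindex x).2 == (unindex y).2).
Proof.
rewrite -(inj_eq (@unindex_inj m n)) -xpair_eqE.
by case: (unindex x); case: (unindex y).
Qed.

Definition block m n (x y : 'I_(m.+1 * n.+1)) : galg R G :=
  E (unindex x).1 (unindex y).1 * F (unindex x).2 (unindex y).2.

Lemma EFEF m n m' n' (i j : 'I_m.+1) (k l : 'I_n.+1) (i' j' : 'I_m'.+1) (k' l' : 'I_n'.+1) :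
  E i j * F k l * (E i' j' * F k' l') = E i j * E i' j' * (F k l * F k' l').
Proof. by rewrite -!mulrA; congr (_ * _); rewrite !mulrA EF. Qed.

Lemma block_mul m n (x y z t : 'I_(m.+1 * n.+1)) :
  block x y * block z t = if y == z then block x t else 0.
Proof.
rewrite /block EFEF (pu_mul puE) (pu_mul puF) unindex_eq.
by case: eqP => _; case: eqP => _; rewrite /= ?mul0r ?mulr0.
Qed.

Lemma block_orth m n m' n' (x y : 'I_(m.+1 * n.+1)) (z t : 'I_(m'.+1 * n'.+1)) :
  (m != m') || (n != n') -> block x y * block z t = 0.
Proof.
rewrite /block EFEF; case/orP => [mm'|nn'].
  by rewrite (pu_orth puE) // mul0r.
by rewrite (pu_orth puF) // mulr0.
Qed.

Lemma star_block m n (x y : 'I_(m.+1 * n.+1)) : star (block x y) = block y x.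
Proof. by rewrite /block starM (pu_star puE) (pu_star puF) EF. Qed.

(** [T] acts on the first index, and [S] commutes past the first factor to act on the second: the
    matrix is $A\otimes1-1\otimes A'$. *)
Lemma block_act m n (x y : 'I_(m.+1 * n.+1)) :
  (T - S) * block x y = \sum_z (twine_mx R m.+1 n.+1 z x)%:C%C *: block z y.
Proof.
case/mxvec_indexP: x => i j; rewrite (reindex _ (curry_mxvec_bij _ _)) /=.
rewrite (eq_bigr (fun z : 'I_m.+1 * 'I_n.+1 =>
   (if z.2 == j then
      (path_mx R m.+1 z.1 i)%:C%C *: (E z.1 (unindex y).1 * F j (unindex y).2) else 0)
 - (if z.1 == i then
      (path_mx R n.+1 z.2 j)%:C%C *: (E i (unindex y).1 * F z.2 (unindex y).2) else 0))).
  rewrite sumrB mulrBl /block !mxvec_indexK /=; congr (_ - _).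
    rewrite mulrA (pu_act puE) mulr_suml.
    rewrite -(pair_bigA _ (fun k l => if l == j then
      (path_mx R m.+1 k i)%:C%C *: (E k (unindex y).1 * F j (unindex y).2) else 0)) /=.
    by apply: eq_bigr => k _; rewrite -big_mkcond big_pred1_eq scalerAl.
  rewrite mulrA SE -mulrA (pu_act puF) mulr_sumr.
  rewrite -(pair_bigA _ (fun k l => if k == i then
      (path_mx R n.+1 l j)%:C%C *: (E i (unindex y).1 * F l (unindex y).2) else 0)) /=.
  rewrite exchange_big /=.
  by apply: eq_bigr => k _; rewrite -big_mkcond big_pred1_eq scalerAr.
move=> [k l] _ /=; rewrite twine_mxE rmorphB scalerBl !rmorphM !rmorph_nat /block !mxvec_indexK /=.
rewrite (path_mx_sym _ i) (path_mx_sym _ j) (eq_sym i) (eq_sym j).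
congr (_ - _).
  by case: eqP => [->|_]; rewrite ?mulr1 ?mulr0 ?scale0r.
by case: eqP => [->|_]; rewrite ?mul1r ?mul0r ?scale0r.
Qed.

Lemma tr_block m n (x y : 'I_(m.+1 * n.+1)) :
  block x y 1%g = if x == y then (w m * v n)%:C%C else 0.
Proof. by rewrite /block trEF unindex_eq. Qed.

Definition block_one m n := mxrep (@block m n) 1%:M.

Lemma kernel_blocks : exists (P B : nat -> nat -> galg R G), forall m n,
  [/\ star (P m n) = P m n, P m n * P m n = P m n, (T - S) * P m n = 0,
    block_one m n - P m n = B m n * (T - S) &
    P m n 1%g = ((gcdn m.+2 n.+2).-1%:R * (w m * v n))%:C%C /\
    exists M, P m n = mxrep (@block m n) M].
Proof.
have Theta_self : star (T - S) = T - S by rewrite starD starN (pu_self puE) (pu_self puF).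
have PB m n := block_kernel (@block_mul m n) (@star_block m n) Theta_self
  (@twine_mx_sym R m.+1 n.+1) (@block_act m n) (@tr_block m n).
pose P m n := proj1_sig (cid (PB m n)).
exists P, (fun m n => proj1_sig (cid (proj2_sig (cid (PB m n))))) => m n.
rewrite /P; case: (cid (PB m n)) => Pmn /= exB; case: (cid exB) => Bmn /=.
(* The paths have [m.+1] and [n.+1] vertices, and the dimension formula raises each size once more;
   hence [m.+2] and [n.+2] in the gcd. *)
by rewrite rank_ker_twine rank_ker_cheb.
Qed.

Lemma tr_block_one m n : block_one m n 1%g = ((m.+1%:R * w m) * (n.+1%:R * v n))%:C%C.
Proof.
rewrite /block_one (tr_mxrep (@tr_block m n)) mxtrace1 natrM; congr (_%:C)%C; ring.
Qed.

Local Open Scope classical_set_scope.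

Hypothesis Ew : (fun N => \sum_(m < N) m.+1%:R * w m) @ \oo --> (1 : R).
Hypothesis Fv : (fun N => \sum_(n < N) n.+1%:R * v n) @ \oo --> (1 : R).
Hypothesis limL : (fun N => \sum_(m < N) \sum_(n < N)
  ((gcdn m.+2 n.+2).-1%:R * (w m * v n))) @ \oo --> L.

(** The block identities with [m, n < N] have total trace a product of two partial sums tending to
    1, so [1 - WN N] can play the part of the vanishing projection in [orth_proj_limit]. *)
Lemma path_units_kernel : exists xi : G -> R[i],
  is_orth_proj (l2ker (T - S)) (delta R (1%g : G)) xi /\ xi 1%g = L%:C%C.
Proof.
have [P [B PB]] := kernel_blocks.
have repM m n m' n' M M' : mxrep (@block m n) M * mxrep (@block m' n') M' =
   if (m == m') && (n == n') then mxrep (@block m n) M * mxrep (@block m' n') M' else 0.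
  case: ifP => // /negbT; rewrite negb_and => mn.
  by apply: mxrep_orth => *; exact: block_orth.
have oneM m n m' n' : block_one m n * block_one m' n' =
   if (m == m') && (n == n') then block_one m n else 0.
  rewrite /block_one repM; case: ifP => // /andP[/eqP <- /eqP <-].
  by rewrite mxrepM ?mulmx1 //; exact: block_mul.
have PP m n m' n' : P m n * P m' n' = if (m == m') && (n == n') then P m n else 0.
  have [_ PP _ _ [_ [M PM]]] := PB m n; have [_ _ _ _ [_ [M' PM']]] := PB m' n'.
  rewrite {1}PM PM' repM -PM -PM'; case: ifP => // /andP[/eqP <- /eqP <-].
  exact: PP.
have star_sq (X : nat -> nat -> galg R G) : (forall m n, star (X m n) = X m n) ->
    forall N, star (square_sum X N) = square_sum X N.
  move=> sX N; rewrite star_sum; apply: eq_bigr => m _.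
  by rewrite star_sum; apply: eq_bigr => n _.
have star_one m n : star (block_one m n) = block_one m n.
  by rewrite /block_one (star_mxrep (@star_block m n)) trmx1.
have tr_sq (X : nat -> nat -> galg R G) (x : nat -> nat -> R) N :
    (forall m n, X m n 1%g = (x m n)%:C%C) ->
    complex.Re (square_sum X N 1%g) = \sum_(m < N) \sum_(n < N) x m n.
  move=> Xx; rewrite gval_sum raddf_sum; apply: eq_bigr => m _.
  by rewrite gval_sum raddf_sum; apply: eq_bigr => n _; rewrite Xx.
pose WN := square_sum block_one.
have WW N : WN N * WN N = WN N by exact: square_sumM.
apply: (@orth_proj_limit _ _ _ (square_sum P) (fun N => 1 - WN N) (square_sum B)).
- by apply: star_sq => m n; have [] := PB m n.
- by move=> N M NM; exact: square_sumM.
- move=> N; rewrite mulr_sumr big1 // => m _; rewrite mulr_sumr big1 // => n _.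
  by have [] := PB m n.
- by move=> N; rewrite starD starN star1 star_sq.
- by move=> N; rewrite mulrBr mulr1 mulrBl mul1r WW subrr subr0.
- move=> N; rewrite opprB addrC addrA subrK /WN /square_sum mulr_suml -sumrB.
  apply: eq_bigr => m _; rewrite mulr_suml -sumrB; apply: eq_bigr => n _.
  by have [] := PB m n.
- have -> : (fun N => complex.Re ((1 - WN N) 1%g)) = (fun N => 1 -
      (\sum_(m < N) m.+1%:R * w m) * (\sum_(n < N) n.+1%:R * v n)).
    apply: boolp.funext => N; rewrite gvalB raddfB gval1 eqxx; congr (_ - _).
    apply: (etrans (tr_sq _ _ _ tr_block_one)); rewrite mulr_suml; apply: eq_bigr => m _.
    by rewrite mulr_sumr.
  have c1 : (fun _ : nat => 1 : R) @ \oo --> (1 : R) by exact: cvg_cst.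
  have := cvgB c1 (cvgM Ew Fv); rewrite mulr1 subrr; exact.
have -> // : (fun N => complex.Re (square_sum P N 1%g)) = (fun N =>
    \sum_(m < N) \sum_(n < N) ((gcdn m.+2 n.+2).-1%:R * (w m * v n))).
apply: boolp.funext => N.
apply: (tr_sq _ (fun m n => (gcdn m.+2 n.+2).-1%:R * (w m * v n))) => m n.
by have [_ _ _ _ []] := PB m n.
Qed.

End PathUnits.

(** * Path blocks from a shifted projection *)

Section ShiftedProjections.
Variables (R : realType) (G : groupType) (e t t' : galg R G).
Hypotheses (tt' : t * t' = 1) (t't : t' * t = 1) (ee : e * e = e).
Hypotheses (star_e : star e = e) (star_t : star t = t').

Definition shifted k := t ^+ k * e * t' ^+ k.

Lemma mul_exprV k : t ^+ k * t' ^+ k = 1.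
Proof.
elim: k => [|k IHk]; first by rewrite mulr1.
by rewrite exprSr exprS mulrA -(mulrA _ t) tt' mulr1.
Qed.

Lemma mul_expr_V k : t' ^+ k * t ^+ k = 1.
Proof.
elim: k => [|k IHk]; first by rewrite mulr1.
by rewrite exprSr exprS mulrA -(mulrA _ t') t't mulr1.
Qed.

Lemma shifted0 : shifted 0 = e.
Proof. by rewrite /shifted mul1r mulr1. Qed.

Lemma shifted_idem k : shifted k * shifted k = shifted k.
Proof. by rewrite /shifted -!mulrA (mulrA (t' ^+ k)) mul_expr_V mul1r (mulrA e e) ee. Qed.

Lemma shifted_mul_t k s : shifted (k + s) * t ^+ s = t ^+ s * shifted k.
Proof.
by rewrite /shifted {1}(addnC k) !exprD -!mulrA mul_expr_V mulr1.
Qed.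

Lemma tV_mul_shifted k s : t' ^+ s * shifted (k + s) = shifted k * t' ^+ s.
Proof.
by rewrite /shifted {1}(addnC k) !exprD !mulrA mul_expr_V mul1r.
Qed.

Lemma star_tX k : star (t ^+ k) = t' ^+ k.
Proof.
by elim: k => [|k IHk]; rewrite ?star1 // exprS starM IHk star_t -exprSr.
Qed.

Lemma star_tVX k : star (t' ^+ k) = t ^+ k.
Proof. by rewrite -star_tX starK. Qed.

Lemma star_shifted k : star (shifted k) = shifted k.
Proof. by rewrite /shifted !starM star_e star_tX star_tVX mulrA. Qed.

End ShiftedProjections.

Section PathUnitsOfShift.
Variables (R : realType) (G : groupType) (e t t' : galg R G) (eps : nat -> galg R G).
Hypotheses (tt' : t * t' = 1) (star_e : star e = e) (star_t : star t = t').
Hypothesis eps0 : eps 0 = e.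
Hypothesis eps_idem : forall k, eps k * eps k = eps k.
Hypothesis eps_comm : forall k l, eps k * eps l = eps l * eps k.
Hypothesis star_eps : forall k, star (eps k) = eps k.
Hypothesis eps_mul_t : forall k s, eps (k + s) * t ^+ s = t ^+ s * eps k.
Hypothesis tV_mul_eps : forall k s, t' ^+ s * eps (k + s) = eps k * t' ^+ s.

(** $(1-e_0)e_1\cdots e_k$, that is $D_k$ without its last factor; the recursion adds one position
    at a time, which suits the trace computation. *)
Fixpoint run k := if k is k'.+1 then run k' * eps k else 1 - eps 0.

(* Locked, since rewriting with [mulrA] would otherwise unfold it as a product. *)
Definition path_proj m := locked (run m * (1 - eps m.+1)).

Lemma path_projE m : path_proj m = run m * (1 - eps m.+1).
Proof. by rewrite /path_proj -lock. Qed.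

Lemma run_comm k l : eps l * run k = run k * eps l.
Proof.
elim: k => [|k IHk] /=; first by rewrite mulrBl mulrBr mul1r mulr1 eps_comm.
by rewrite mulrA IHk -!mulrA eps_comm.
Qed.

Lemma path_proj_comm m l : eps l * path_proj m = path_proj m * eps l.
Proof.
by rewrite path_projE mulrA run_comm -!mulrA mulrBl mulrBr mul1r mulr1 eps_comm.
Qed.

Lemma run0 k : run k * eps 0 = 0.
Proof.
elim: k => [|k IHk]; first by rewrite /= mulrBl mul1r eps_idem subrr.
by rewrite /= -mulrA eps_comm mulrA IHk mul0r.
Qed.

Lemma run_absorb k l : (0 < l <= k)%N -> run k * eps l = run k.
Proof.
elim: k => [|k IHk]; first by lia.
move=> lk; have [->|lk'] := eqVneq l k.+1; first by rewrite /= -mulrA eps_idem.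
by rewrite /= -mulrA eps_comm mulrA IHk //; lia.
Qed.

Lemma path_proj0 m : path_proj m * eps 0 = 0.
Proof. by rewrite -path_proj_comm path_projE mulrA run_comm run0 mul0r. Qed.

Lemma path_proj_absorb m l : (0 < l <= m)%N -> path_proj m * eps l = path_proj m.
Proof. by move=> lm; rewrite -path_proj_comm path_projE mulrA run_comm run_absorb. Qed.

Lemma path_proj_last m : path_proj m * eps m.+1 = 0.
Proof. by rewrite path_projE -mulrA mulrBl mul1r eps_idem subrr mulr0. Qed.

Lemma run_idem k : run k * run k = run k.
Proof.
elim: k => [|k IHk] /=.
  by rewrite mulrBr mulr1 mulrBl mul1r eps_idem subrr subr0.
by rewrite mulrA -(mulrA (run k) (eps _)) run_comm mulrA IHk -mulrA eps_idem.
Qed.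

Lemma path_proj_idem m : path_proj m * path_proj m = path_proj m.
Proof.
rewrite {2}path_projE mulrA.
have -> : path_proj m * run m = path_proj m.
  by rewrite path_projE mulrBr mulr1 mulrBl -mulrA run_comm mulrA run_idem.
by rewrite mulrBr mulr1 path_proj_last subr0.
Qed.

Lemma star_run k : star (run k) = run k.
Proof.
elim: k => [|k IHk]; first by rewrite /= starD starN star1 star_eps.
by rewrite /= starM IHk star_eps run_comm.
Qed.

Lemma star_path_proj m : star (path_proj m) = path_proj m.
Proof.
rewrite path_projE starM star_run starD starN star1 star_eps.
by rewrite mulrBl mulrBr mul1r mulr1 run_comm.
Qed.

(** $D_m$ absorbs $e_s$, and $e_st^s=t^se_0$ brings $e_0$ next to $D_n$, which kills it. *)
Lemma path_proj_t m n s : (0 < s <= m)%N -> path_proj m * t ^+ s * path_proj n = 0.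
Proof.
move=> sm; have := eps_mul_t 0 s; rewrite add0n => et.
rewrite -(path_proj_absorb sm) -(mulrA _ (eps s)) et -(mulrA _ _ (path_proj n)).
by rewrite -(mulrA (t ^+ s)) path_proj_comm path_proj0 !mulr0.
Qed.

Lemma path_proj_t' m n s : (0 < s <= n)%N -> path_proj m * t' ^+ s * path_proj n = 0.
Proof.
move=> sn; have := tV_mul_eps 0 s; rewrite add0n => te.
rewrite -(path_proj_absorb sn) -(path_proj_comm n s) mulrA -(mulrA (path_proj m)).
by rewrite te (mulrA (path_proj m) (eps 0)) path_proj0 !mul0r.
Qed.

(** For $k<l$ the factor $1-e_{k+1}$ of $D_k$ meets the factor $e_{k+1}$ of $D_l$; the other order
    follows by taking stars. *)
Lemma path_proj_orth m n : m != n -> path_proj m * path_proj n = 0.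
Proof.
have lt k l : (k < l)%N -> path_proj k * path_proj l = 0.
  move=> kl; rewrite -(@path_proj_absorb l k.+1) // -(path_proj_comm l).
  by rewrite mulrA path_proj_last mul0r.
rewrite neq_ltn => /orP[/lt //|/lt nm].
by apply: (inv_inj (@starK R G)); rewrite starM !star_path_proj nm star0.
Qed.

Definition path_unit m (i j : 'I_m.+1) := t' ^+ i.+1 * path_proj m * t ^+ j.+1.

Lemma path_unitM m n (i j : 'I_m.+1) (k l : 'I_n.+1) :
  path_unit i j * path_unit k l =
  t' ^+ i.+1 * (path_proj m * (t ^+ j.+1 * t' ^+ k.+1) * path_proj n) * t ^+ l.+1.
Proof. by rewrite /path_unit !mulrA. Qed.

Lemma mul_exprV_ge j k : (k <= j)%N -> t ^+ j * t' ^+ k = t ^+ (j - k).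
Proof. by move=> kj; rewrite -{1}(subnK kj) exprD -mulrA (mul_exprV tt') mulr1. Qed.

Lemma mul_exprV_le j k : (j <= k)%N -> t ^+ j * t' ^+ k = t' ^+ (k - j).
Proof. by move=> kj; rewrite -{1}(subnKC kj) exprD mulrA (mul_exprV tt') mul1r. Qed.

(** The inner powers of $t$ leave a nonzero offset, at most $n$ if it is negative and at most $m$ if
    it is positive: the ranges of [path_proj_t'] and [path_proj_t]. *)
Lemma path_unitM0 m n (i j : 'I_m.+1) (k l : 'I_n.+1) : j != k :> nat ->
  path_unit i j * path_unit k l = 0.
Proof.
rewrite path_unitM neq_ltn => /orP[jk|kj].
  rewrite mul_exprV_le; last lia.
  by rewrite path_proj_t' ?mulr0 ?mul0r //; have := ltn_ord k; lia.
rewrite mul_exprV_ge; last lia.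
by rewrite path_proj_t ?mulr0 ?mul0r //; have := ltn_ord j; lia.
Qed.

Definition shift_op := e * t + t' * e.

(** $et$ lowers the row index and $t^{-1}e$ raises it: moved past the powers of $t$, the factor $e$
    becomes $e_i$ or $e_{i+1}$ beside $D_m$. It is absorbed there, except at the ends $e_0$ and
    $e_{m+1}$, where the product is 0. *)
Lemma shift_op_path_unit m (i j : 'I_m.+1) : shift_op * path_unit i j =
  \sum_(k < m.+1) (path_mx R m.+1 k i)%:C%C *: path_unit k j.
Proof.
pose Z k := t' ^+ k.+1 * path_proj m * t ^+ j.+1.
have down : e * t * path_unit i j = if (0 < i)%N then Z i.-1 else 0.
  rewrite /path_unit exprS !mulrA -(mulrA e) tt' mulr1 -eps0 -tV_mul_eps add0n.
  rewrite -(mulrA (t' ^+ i)) path_proj_comm.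
  case: (posnP i) => [->|i0]; first by rewrite path_proj0 mulr0 mul0r.
  by rewrite path_proj_absorb /Z ?prednK //; have := ltn_ord i; lia.
have up : t' * e * path_unit i j = if (i < m)%N then Z i.+1 else 0.
  rewrite /path_unit !mulrA -(mulrA t' e) -{1}eps0 -tV_mul_eps add0n.
  rewrite mulrA -exprS -(mulrA (t' ^+ _)) path_proj_comm.
  case: ltnP => im; first by rewrite path_proj_absorb.
  have -> : nat_of_ord i = m by have := ltn_ord i; lia.
  by rewrite path_proj_last mulr0 mul0r.
rewrite /shift_op mulrDl down up.
rewrite (eq_bigr (fun k : 'I_m.+1 => (if k.+1 == i then Z k else 0)
                                   + (if k == i.+1 :> nat then Z k else 0))).
  rewrite big_split; congr (_ + _); rewrite -big_mkcond /=.
    case: posnP => [i0|i0]; first by rewrite big1 // => k; rewrite i0.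
    have im : (i.-1 < m.+1)%N by have := ltn_ord i; lia.
    rewrite (big_pred1 (Ordinal im)) // => k.
    by apply/eqP/eqP => [ki|->] /=; [apply: val_inj => /=; lia | lia].
  case: ltnP => im; last by rewrite big1 // => k /eqP ki; have := ltn_ord k; lia.
  by rewrite (big_pred1 (Ordinal (im : (i.+1 < m.+1)%N))).
move=> k _; rewrite mxE rmorph_nat (eq_sym (i.+1)).
have [ki|] := eqVneq k.+1 (i : nat).
  by rewrite ltn_eqF ?addr0 ?scale1r //; lia.
move=> _; rewrite orFb; case: eqP => _; rewrite ?scale1r ?scale0r.
  by rewrite add0r.
by rewrite addr0.
Qed.

Lemma shifted_path_units : path_units shift_op path_unit.
Proof.
split.
- move=> m i j k l; have [<-|jk] := eqVneq j k; last exact: path_unitM0.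
  by rewrite path_unitM (mul_exprV tt') mulr1 path_proj_idem.
- move=> m n i j k l mn; have [jk|jk] := eqVneq (j : nat) k; last exact: path_unitM0.
  by rewrite path_unitM jk (mul_exprV tt') mulr1 path_proj_orth // mulr0 mul0r.
- move=> m i j; rewrite /path_unit !starM (star_tX star_t) (star_tVX star_t).
  by rewrite star_path_proj mulrA.
- exact: shift_op_path_unit.
- have star_t' : star t' = t by rewrite -star_t starK.
  by rewrite /shift_op starD !starM star_e star_t star_t' addrC.
Qed.

End PathUnitsOfShift.

Section PushUnits.
Variables (R : realType) (G H : groupType) (phi : G -> H).
Hypothesis phiM : {morph phi : x y / (x * y)%g}.

Lemma push_path_units (T : galg R G) (E : forall m, 'I_m.+1 -> 'I_m.+1 -> galg R G) :
  path_units T E -> path_units (gpush phi T) (fun m i j => gpush phi (E m i j)).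
Proof.
case=> EM EO ES ET TS; split.
- by move=> m i j k l; rewrite -gpushM // EM; case: ifP => // _; rewrite gpush0.
- by move=> m n i j k l mn; rewrite -gpushM // EO // gpush0.
- by move=> m i j; rewrite -gpush_star // ES.
- move=> m i j; rewrite -gpushM // ET.
  rewrite (big_morph _ (@gpushD R _ _ phi) (@gpush0 R _ _ phi)).
  by apply: eq_bigr => k _; rewrite gpushZ.
- by rewrite -gpush_star // TS.
Qed.

End PushUnits.

(** * Wreath products *)

Section WreathGroup.
Variable U : groupType.
Implicit Types x y : wreath U.

Lemma wbaseM x y n : wbase (x * y)%g n = (wbase x n * wbase y (n + wexp x))%g.
Proof. by rewrite /= mulfE shiftfE. Qed.

Lemma wexpM x y : wexp (x * y)%g = wexp x + wexp y. Proof. by []. Qed.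

Lemma wbase1 n : wbase (1%g : wreath U) n = 1%g. Proof. exact: onefE. Qed.
Lemma wreath_eq x y : wexp x = wexp y -> (forall n, wbase x n = wbase y n) -> x = y.
Proof. by case: x y => [f a] [g b] /= -> fg; congr Wreath; apply/fsfunP. Qed.

Lemma wembedE (u : U) n : wbase (wembed u) n = if n == 0 then u else 1%g.
Proof. by rewrite /= fsfun_fun in_fset1. Qed.

Lemma wembedM : {morph @wembed U : u v / (u * v)%g}.
Proof.
move=> u v; apply: wreath_eq => // n; rewrite wbaseM !wembedE /= addr0.
by case: eqP; rewrite ?mulg1.
Qed.

Lemma wembed_inj : injective (@wembed U).
Proof. by move=> u v /(congr1 (fun x => wbase x 0)); rewrite !wembedE eqxx. Qed.

Definition wshift (a : int) : wreath U := Wreath (onef U) a.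

Lemma wshiftM a b : (wshift a * wshift b)%g = wshift (a + b).
Proof. by apply: wreath_eq => // n; rewrite wbaseM /= !onefE mulg1. Qed.

Lemma wshiftV a : (wshift a)^-1%g = wshift (- a).
Proof. by apply: mulg1_eq; rewrite wshiftM subrr; apply: wreath_eq. Qed.

(** The sign comes from $t^{-1}(g_n)t=(g_{n-1})$: passing from $e$ to $t^ket^{-k}$ moves position 0
    to $-k$. *)
Definition at_pos k x :=
  wexp x = 0 /\ forall n, n != - k%:Z -> wbase x n = 1%g.

Lemma at_pos_comm k l x y : k != l -> at_pos k x -> at_pos l y -> (x * y = y * x)%g.
Proof.
move=> kl [x0 xk] [y0 yl]; apply: wreath_eq; first by rewrite !wexpM addrC.
move=> n; rewrite !wbaseM x0 y0 !addr0.
have [nk|nk] := eqVneq n (- k%:Z); last by rewrite xk // mulg1 mul1g.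
by rewrite yl ?mulg1 ?mul1g //; apply: contraNneq kl; lia.
Qed.

Definition above_pos k x :=
  wexp x = 0 /\ forall n, n < - k%:Z -> wbase x n = 1%g.

Lemma at_above_pos k x : at_pos k x -> above_pos k x.
Proof. by move=> [x0 xk]; split=> // n nk; apply: xk; lia. Qed.

Lemma above_posM k x y : above_pos k x -> at_pos k.+1 y -> above_pos k.+1 (x * y)%g.
Proof.
move=> [x0 xk] [y0 yk]; split; first by rewrite wexpM x0 y0.
by move=> n nk; rewrite wbaseM x0 addr0 xk ?yk ?mulg1 //; lia.
Qed.

(** From position $-k$ on, [y] is trivial and [x] agrees with the product; below it [x] is trivial
    by assumption. This supplies the hypothesis of [trM_indep]. *)
Lemma above_pos_indep k x y :
  above_pos k x -> at_pos k.+1 y -> (x * y = 1)%g -> x = 1%g.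
Proof.
move=> [x0 xk] [y0 yk] xy; apply: wreath_eq => // n; rewrite wbase1.
have [nk|nk] := ltP n (- k%:Z); first exact: xk.
have := congr1 (fun z => wbase z n) xy; rewrite wbaseM x0 addr0 yk ?mulg1 ?wbase1 //.
by lia.
Qed.

End WreathGroup.

Section WreathUnits.
Variables (R : realType) (U : groupType) (e0 : galg R U) (p : R).
Hypotheses (ee : e0 * e0 = e0) (star_e : star e0 = e0) (tr_e : e0 1%g = p%:C%C).

Let e := gpush (@wembed U) e0.
Let t := gdelta R (wgen U).
Let t' := gdelta R (wgen U)^-1%g.
Let eps := shifted e t t'.

Lemma wgen_expr k : t ^+ k = gdelta R (wshift U k%:Z).
Proof.
elim: k => [|k IHk]; first by rewrite expr0 -gdelta1; congr gdelta; apply: wreath_eq.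
rewrite exprS IHk gdeltaM; congr gdelta.
by rewrite -[wgen U]/(wshift U 1) wshiftM; congr wshift; lia.
Qed.

Lemma wgenV_expr k : t' ^+ k = gdelta R (wshift U (- k%:Z)).
Proof.
elim: k => [|k IHk]; first by rewrite expr0 -gdelta1; congr gdelta; apply: wreath_eq.
rewrite exprS IHk gdeltaM; congr gdelta.
by rewrite -[wgen U]/(wshift U 1) wshiftV wshiftM; congr wshift; lia.
Qed.

Lemma wgen_mulV : t * t' = 1.
Proof. by rewrite gdeltaM mulgV. Qed.
Lemma wgen_Vmul : t' * t = 1.
Proof. by rewrite gdeltaM mulVg. Qed.

Lemma wproj_idem : e * e = e.
Proof. by rewrite -(gpushM (@wembedM U)) ee. Qed.
Lemma star_wproj : star e = e.
Proof. by rewrite -(gpush_star (@wembedM U)) star_e. Qed.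
Lemma star_wgen : star t = t'.
Proof. exact: star_delta. Qed.

Lemma wepsE k x : eps k x = e (wshift U (- k%:Z) * (x * wshift U k%:Z))%g.
Proof.
by rewrite /eps /shifted wgen_expr wgenV_expr gval_Mdelta gval_deltaM !wshiftV opprK.
Qed.

Lemma weps_supp k x : eps k x != 0 -> at_pos k x.
Proof.
rewrite wepsE => /gpush_supp[u _ xu].
have -> : x = (wshift U k%:Z * wembed u * wshift U (- k%:Z))%g.
  by rewrite -xu -wshiftV mulVKg mulgK.
split=> [|n nk]; first by rewrite !wexpM /= addr0 subrr.
rewrite !wbaseM /= !onefE mul1g mulg1 -[[fsfun _ in _ => _ | _]]/(wbase (wembed u)) wembedE.
by rewrite ifF //; apply: contraNF nk => /eqP; lia.
Qed.

Lemma weps_comm k l : eps k * eps l = eps l * eps k.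
Proof.
have [->//|kl] := eqVneq k l.
by apply: comm_supp => x y /weps_supp kx /weps_supp ly; exact: at_pos_comm kl kx ly.
Qed.

Let D := path_proj eps.

Lemma wreath_path_units : path_units (e * t + t' * e) (fun m => @path_unit R _ t t' eps m).
Proof.
apply: shifted_path_units; first exact: wgen_mulV.
- exact: star_wproj.
- exact: star_wgen.
- exact: shifted0.
- by move=> k; apply: shifted_idem wgen_Vmul wproj_idem k.
- exact: weps_comm.
- by move=> k; apply: star_shifted star_wproj star_wgen k.
- by move=> k s; apply: shifted_mul_t wgen_Vmul k s.
- by move=> k s; apply: tV_mul_shifted wgen_Vmul k s.
Qed.

Lemma weps1_supp k x : (1 - eps k) x != 0 -> at_pos k x.
Proof.
rewrite gvalB gval1; case: (eqVneq x 1%g) => [-> _|_].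
  by split=> // n _; exact: wbase1.
by rewrite sub0r oppr_eq0; exact: weps_supp.
Qed.

Lemma wrun_supp k x : run eps k x != 0 -> above_pos k x.
Proof.
elim: k x => [|k IHk] x; first by move=> h; apply: at_above_pos; exact: weps1_supp.
by case/gmul_supp => y [z [/IHk yk /weps_supp zk ->]]; exact: above_posM.
Qed.

Lemma weps_tr k : eps k 1%g = p%:C%C.
Proof.
rewrite wepsE mul1g wshiftM addNr -tr_e -(gpush_val e0 1%g (@wembed_inj U)).
by congr (gval _ _); apply: wreath_eq => // n; rewrite wembedE if_same; exact: onefE.
Qed.

Lemma wrun_tr k : run eps k 1%g = ((1 - p) * p ^+ k)%:C%C.
Proof.
elim: k => [|k IHk]; first by rewrite gvalB gval1 eqxx weps_tr mulr1 rmorphB.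
rewrite -[run eps k.+1]/(run eps k * eps k.+1).
rewrite trM_indep => [|x y /wrun_supp kx /weps_supp ky]; last first.
  exact: above_pos_indep kx ky.
by rewrite IHk weps_tr -rmorphM exprSr mulrA.
Qed.

Lemma path_proj_supp m x : D m x != 0 -> above_pos m.+1 x.
Proof.
rewrite /D path_projE => /gmul_supp[y [z [/wrun_supp yk /weps1_supp zk ->]]].
exact: above_posM.
Qed.

Lemma path_proj_tr m : D m 1%g = ((1 - p) ^+ 2 * p ^+ m)%:C%C.
Proof.
rewrite /D path_projE trM_indep => [|x y /wrun_supp kx /weps1_supp ky]; last first.
  exact: above_pos_indep kx ky.
by rewrite wrun_tr gvalB gval1 eqxx weps_tr -rmorphB -rmorphM; congr (_%:C)%C; ring.
Qed.

(** The coefficient at 1 is the value of $D_m$ at the pure shift by $i-j$, and $D_m$ lives on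
    elements of exponent 0. *)
Lemma path_unit_tr m (i j : 'I_m.+1) : path_unit t t' eps i j 1%g =
  if i == j then ((1 - p) ^+ 2 * p ^+ m)%:C%C else 0.
Proof.
rewrite /path_unit wgen_expr wgenV_expr gval_Mdelta gval_deltaM mul1g !wshiftV wshiftM opprK.
case: eqVneq => [->|ij].
  by rewrite subrr -path_proj_tr.
apply/eqP; apply: contraNT ij => /path_proj_supp[/= ij _].
by apply/eqP/val_inj => /=; lia.
Qed.

End WreathUnits.

(** * Series *)

Section Series.
Local Open Scope classical_set_scope.
Variable R : realType.
Implicit Types p q : R.

Lemma geometric_sum p N : (1 - p) * (\sum_(m < N) p ^+ m) = 1 - p ^+ N.
Proof. by rewrite -opprB mulNr -subrX1 opprB. Qed.

Lemma arith_geometric_sum p N : \sum_(m < N) m.+1%:R * ((1 - p) ^+ 2 * p ^+ m) =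
  1 - p ^+ N - (1 - p) * (N%:R * p ^+ N).
Proof.
elim: N => [|N IHN]; first by rewrite big_ord0; ring.
by rewrite big_ord_recr /= IHN -natr1 (exprS p N); ring.
Qed.

Lemma arith_geometric_le1 p N : 0 < p < 1 ->
  \sum_(m < N) m.+1%:R * ((1 - p) ^+ 2 * p ^+ m) <= 1.
Proof.
move=> /andP[p0 p1]; rewrite arith_geometric_sum.
have pX : 0 <= p ^+ N by rewrite exprn_ge0 // ltW.
have : 0 <= (1 - p) * (N%:R * p ^+ N) by rewrite !mulr_ge0 //; lra.
lra.
Qed.

Lemma geometric_sum_le p N : 0 < p < 1 -> \sum_(m < N) p ^+ m.+1 <= p / (1 - p).
Proof.
move=> /andP[p0 p1]; have q0 : 0 < 1 - p by lra.
rewrite ler_pdivlMr // mulrC (eq_bigr (fun m : 'I_N => p * p ^+ m)) => [|m _]; last first.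
  by rewrite exprS.
rewrite -mulr_sumr mulrCA geometric_sum ler_piMr ?(ltW p0) //.
by rewrite gerBl exprn_ge0 // ltW.
Qed.

(** The delicate term of the closed form is $Np^N$. The sums increase and are bounded by 1, hence
    converge, so their increments tend to 0; rewriting $Np^N$ through these increments identifies
    the limit. *)
Lemma cvg_arith_geometric p : 0 < p < 1 ->
  (fun N => \sum_(m < N) m.+1%:R * ((1 - p) ^+ 2 * p ^+ m)) @ \oo --> (1 : R).
Proof.
move=> /andP[p0 p1]; set T := fun N : nat => _.
have pX N : 0 <= p ^+ N by rewrite exprn_ge0 // ltW.
have q0 : 0 < 1 - p by rewrite subr_gt0.
have ndT : nondecreasing_seq T.
  apply/nondecreasing_seqP => N; rewrite /T big_ord_recr /= lerDl.
  by apply: mulr_ge0 => //; apply: mulr_ge0 => //; exact: sqr_ge0.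
have cT : cvgn T.
  apply: nondecreasing_is_cvgn => //; exists 1 => _ [N _ <-].
  by apply: arith_geometric_le1; rewrite p0.
have cpX : (fun N : nat => p ^+ N) @ \oo --> (0 : R).
  by apply: cvg_expr; rewrite gtr0_norm.
have cterm : (fun N => T N.+1 - T N) @ \oo --> (0 : R).
  rewrite -(subrr (lim (T @ \oo))); apply: cvgB => //.
  by rewrite (cvg_shiftS T).
have c2 : (fun N : nat => 1 - p ^+ N - (1 - p)^-1 * (T N.+1 - T N) + (1 - p) * p ^+ N)
    @ \oo --> 1 - 0 - (1 - p)^-1 * 0 + (1 - p) * 0.
  apply: cvgD; last by apply: cvgM => //; exact: cvg_cst.
  apply: cvgB; last by apply: cvgM => //; exact: cvg_cst.
  by apply: cvgB => //; exact: cvg_cst.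
rewrite !mulr0 !subr0 addr0 in c2.
have -> // : T = (fun N : nat => 1 - p ^+ N - (1 - p)^-1 * (T N.+1 - T N) + (1 - p) * p ^+ N).
apply: funext => N; have -> : T N.+1 - T N = N.+1%:R * ((1 - p) ^+ 2 * p ^+ N).
  by rewrite /T big_ord_recr /= [X in X - _]addrC addrK.
rewrite /T arith_geometric_sum -natr1; field.
by rewrite gt_eqF.
Qed.

Lemma cvg_geometric_sum p : 0 < p < 1 ->
  (fun N => \sum_(m < N) p ^+ m.+1) @ \oo --> (p^-1 - 1)^-1.
Proof.
move=> /andP[p0 p1]; have q0 : 1 - p != 0 by rewrite subr_eq0 gt_eqF.
have -> : (fun N => \sum_(m < N) p ^+ m.+1) = (fun N => p / (1 - p) * (1 - p ^+ N)).
  apply: funext => N; rewrite -geometric_sum mulrA divfK // mulr_sumr.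
  by apply: eq_bigr => m _; rewrite exprS.
have -> : (p^-1 - 1)^-1 = p / (1 - p) * (1 - 0).
  by rewrite subr0 mulr1; field; rewrite q0 gt_eqF.
apply: cvgM; first exact: cvg_cst.
apply: cvgB; first exact: cvg_cst.
by apply: cvg_expr; rewrite gtr0_norm.
Qed.

(** Every finite set of positive pairs lies in a square, so for nonnegative terms the squares
    already compute the supremum. *)
Lemma esum_square (f : nat -> nat -> R) (ell : R) : (forall m n, 0 <= f m n) ->
  (forall N, \sum_(m < N) \sum_(n < N) f m.+1 n.+1 <= ell) ->
  (fun N => \sum_(m < N) \sum_(n < N) f m.+1 n.+1) @ \oo --> ell ->
  esum [set mn : nat * nat | (0 < mn.1)%N /\ (0 < mn.2)%N]
    (fun mn => (f mn.1 mn.2)%:E) = ell%:E.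
Proof.
move=> f0 fle fcvg.
pose s N : seq (nat * nat) := [seq (m, n) | m <- iota 1 N, n <- iota 1 N].
have s_uniq N : uniq (s N) by rewrite allpairs_uniq ?iota_uniq // => -[? ?] [? ?].
have iota1 N (F : nat -> R) : \sum_(i <- iota 1 N) F i = \sum_(i < N) F i.+1.
  have -> : iota 1 N = [seq (1 + i)%N | i <- iota 0 N] by rewrite -iotaDl.
  by rewrite big_map -(big_mkord xpredT (fun i => F i.+1)) /index_iota subn0.
have sE N : (\sum_(x \in [set` s N]) (f x.1 x.2)%:E =
    (\sum_(m < N) \sum_(n < N) f m.+1 n.+1)%:E)%E.
  rewrite -fsbig_seq //= sumEFin big_allpairs; congr (_%:E).
  by rewrite iota1; apply: eq_bigr => m _; rewrite iota1.
have sP N x : (x \in s N) = (0 < x.1 <= N)%N && (0 < x.2 <= N)%N.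
  case: x => m n; apply/allpairsP/idP => /= [[[a b] [/=]]|].
    by rewrite !mem_iota => ha hb [-> ->]; lia.
  by move=> /andP[hm hn]; exists (m, n); rewrite /= !mem_iota; split=> //; lia.
have fE0 x : (0 <= (f x.1 x.2)%:E)%E by rewrite lee_fin.
have sub N : [set` s N] `<=` [set mn : nat * nat | (0 < mn.1)%N /\ (0 < mn.2)%N].
  by move=> x /=; rewrite sP => /andP[/andP[? _] /andP[? _]].
have le_ell : (esum [set mn : nat * nat | (0 < mn.1)%N /\ (0 < mn.2)%N]
    (fun mn => (f mn.1 mn.2)%:E) <= ell%:E)%E.
  apply: ge_ereal_sup => _ [F [finF Fpos] <-].
  pose N := \max_(x <- fset_set F) maxn x.1 x.2.
  apply: (@le_trans _ _ (\sum_(x \in [set` s N]) (f x.1 x.2)%:E)%E); last first.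
    by rewrite sE lee_fin.
  apply: lee_fsum_nneg_subset => //= x; rewrite in_setE => Fx.
  have [x1 x2] := Fpos x Fx.
  have : (maxn x.1 x.2 <= N)%N.
    by apply: leq_bigmax_seq => //; rewrite in_fset_set ?inE.
  by move=> xN; apply/mem_set; rewrite /= sP x1 x2 /= -geq_max.
apply/eqP; rewrite eq_le le_ell /=.
have ge0 : (0 <= esum [set mn : nat * nat | (0 < mn.1)%N /\ (0 < mn.2)%N]
    (fun mn => (f mn.1 mn.2)%:E))%E by exact: esum_ge0.
have fN N : ((\sum_(m < N) \sum_(n < N) f m.+1 n.+1)%:E <=
    esum [set mn : nat * nat | (0 < mn.1)%N /\ (0 < mn.2)%N]
    (fun mn => (f mn.1 mn.2)%:E))%E.
  rewrite -sE; apply: esum_ge; exists [set` s N] => //.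
  by split; [exact: finite_seq | exact: sub].
move: le_ell ge0 fN; case: (esum _ _) => [r||] // _ _ fN; rewrite lee_fin.
have cr : (fun _ : nat => r) @ \oo --> r by exact: cvg_cst.
by apply: (ler_cvg_to fcvg cr); apply: nearW => N; rewrite -lee_fin.
Qed.

Lemma gcd_series_cvg (X Y : R) : 1 < X -> 1 < Y -> exists2 ell : R,
  gcd_series X Y = ell%:E &
  (fun N => \sum_(m < N) \sum_(n < N) (gcdn m.+1 n.+1)%:R / (X ^+ m.+1 * Y ^+ n.+1))
    @ \oo --> ell.
Proof.
move=> X1 Y1; pose f m n : R := (gcdn m n)%:R / (X ^+ m * Y ^+ n).
have X0 : 0 < X by lra.
have Y0 : 0 < Y by lra.
have f0 m n : 0 <= f m n.
  by rewrite divr_ge0 // mulr_ge0 // exprn_ge0 // ltW.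
set A := fun N : nat => _.
have ndA : nondecreasing_seq A.
  apply/nondecreasing_seqP => N; rewrite /A big_ord_recr /=.
  rewrite ler_wpDr ?sumr_ge0 // => [n _|]; first exact: f0.
  by apply: ler_sum => m _; rewrite big_ord_recr /= lerDl; exact: f0.
have p1 (Z : R) : 1 < Z -> 0 < Z^-1 < 1.
  by move=> Z1; rewrite invr_gt0 invf_lt1; lra.
have cA : cvgn A.
  apply: nondecreasing_is_cvgn => //.
  set p := X^-1; set q := Y^-1.
  (* From $\gcd(m,n)\le m$ the double sum is at most $\sum mp^m\cdot\sum q^n$, and these series sum
     to the two factors. *)
  exists (p / (1 - p) ^+ 2 * (q / (1 - q))) => _ [N _ <-].
  have /andP[p0 p1'] : 0 < p < 1 by exact: p1.
  apply: (@le_trans _ _ ((\sum_(m < N) m.+1%:R * p ^+ m.+1) * \sum_(n < N) q ^+ n.+1)).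
    rewrite mulr_suml; apply: ler_sum => m _; rewrite mulr_sumr; apply: ler_sum => n _.
    rewrite -mulrA /p /q !exprVn -invfM ler_wpM2r //.
      by rewrite invr_ge0 mulr_ge0 // exprn_ge0 // ltW.
    by rewrite ler_nat dvdn_leq // dvdn_gcdl.
  apply: ler_pM.
  - by apply: sumr_ge0 => m _; rewrite mulr_ge0 // exprn_ge0 // ltW.
  - by apply: sumr_ge0 => m _; rewrite exprn_ge0 // invr_ge0 ltW.
  - rewrite (eq_bigr (fun m : 'I_N => p / (1 - p) ^+ 2 * (m.+1%:R * ((1 - p) ^+ 2 * p ^+ m)))).
      rewrite -mulr_sumr ler_piMr ?arith_geometric_le1 ?p0 //.
      by rewrite divr_ge0 ?sqr_ge0 // ltW.
    by move=> m _; rewrite exprS; field; lra.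
  - by apply: geometric_sum_le; exact: p1.
exists (lim (A @ \oo)) => //.
by apply: (@esum_square f) => // N; exact: nondecreasing_cvgn_le.
Qed.

End Series.

(** * The kernel of T - S *)

Section TraceLimit.
Variable R : realType.
Local Open Scope classical_set_scope.

(* Passing from [m + 2, n + 2] to all positive indices adds only terms whose gcd
   is 1, which the subtraction cancels. *)
Lemma cvg_kernel_trace (X Y ell : R) : 1 < X -> 1 < Y ->
  (fun N => \sum_(m < N) \sum_(n < N) (gcdn m.+1 n.+1)%:R / (X ^+ m.+1 * Y ^+ n.+1))
    @ \oo --> ell ->
  (fun N => \sum_(m < N) \sum_(n < N) ((gcdn m.+2 n.+2).-1%:R *
      (((1 - X^-1) ^+ 2 * X^-1 ^+ m) * ((1 - Y^-1) ^+ 2 * Y^-1 ^+ n)))) @ \oo -->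
  (X - 1) ^+ 2 * (Y - 1) ^+ 2 * ell - (X - 1) * (Y - 1).
Proof.
move=> X1 Y1; set A := fun N : nat => _ => cA.
have p1 (Z : R) : 1 < Z -> 0 < Z^-1 < 1 by move=> Z1; rewrite invr_gt0 invf_lt1; lra.
pose B N : R := (\sum_(m < N) X^-1 ^+ m.+1) * (\sum_(n < N) Y^-1 ^+ n.+1).
have cB : B @ \oo --> (X^-1^-1 - 1)^-1 * (Y^-1^-1 - 1)^-1.
  exact: (cvgM (cvg_geometric_sum (p1 _ X1)) (cvg_geometric_sum (p1 _ Y1))).
(* The subtracted product is $\sum_{m,n\ge1}X^{-m}Y^{-n}=1/((X-1)(Y-1))$, so the prefactor turns it
   into $(X-1)(Y-1)$. *)
have -> : (X - 1) ^+ 2 * (Y - 1) ^+ 2 * ell - (X - 1) * (Y - 1) =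
    (X - 1) ^+ 2 * (Y - 1) ^+ 2 * (ell - (X^-1^-1 - 1)^-1 * (Y^-1^-1 - 1)^-1).
  by rewrite !invrK; field; lra.
have cAB : (fun N => A N.+1 - B N.+1) @ \oo --> ell - (X^-1^-1 - 1)^-1 * (Y^-1^-1 - 1)^-1.
  by apply: cvgB; [move: cA|move: cB]; rewrite -cvg_shiftS.
have cK : (fun _ : nat => (X - 1) ^+ 2 * (Y - 1) ^+ 2) @ \oo --> (X - 1) ^+ 2 * (Y - 1) ^+ 2.
  exact: cvg_cst.
apply: cvg_trans (cvgM cK cAB); apply: near_eq_cvg; apply: nearW => N /=.
pose g m n : R := (gcdn m.+1 n.+1)%:R / (X ^+ m.+1 * Y ^+ n.+1) - X^-1 ^+ m.+1 * Y^-1 ^+ n.+1.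
have -> : A N.+1 - B N.+1 = \sum_(m < N.+1) \sum_(n < N.+1) g m n.
  rewrite /A /B /= mulr_suml -sumrB; apply: eq_bigr => m _.
  by rewrite mulr_sumr -sumrB.
have g0 m n : gcdn m.+1 n.+1 = 1%N -> g m n = 0.
  by move=> gE; rewrite /g gE mul1r invfM !exprVn subrr.
rewrite big_ord_recl /= big1 ?add0r => [|n _]; last by rewrite g0 // gcd1n.
rewrite mulr_sumr; apply: eq_bigr => m _.
rewrite big_ord_recl /= g0 ?gcdn1 // add0r mulr_sumr; apply: eq_bigr => n _.
rewrite /g /= /bump /= !add1n -subn1 natrB ?gcdn_gt0 // !exprVn !(exprS X) !(exprS Y).
have Xm : X ^+ m != 0 by rewrite expf_neq0 //; lra.
have Yn : Y ^+ n != 0 by rewrite expf_neq0 //; lra.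
by field; rewrite Xm Yn; lra.
Qed.

End TraceLimit.

(** * Traces of nontrivial projections *)

Section ProjectionTrace.
Variables (R : realType) (U : groupType).

Lemma sqnormc_gt0 (z : R[i]) : z != 0 -> 0 < sqnormc z.
Proof.
move=> z0; rewrite lt_neqAle sqnormc_ge0 andbT eq_sym; apply: contra z0.
case: z => [x y]; rewrite /sqnormc /= paddr_eq0 ?sqr_ge0 // !sqrf_eq0.
by move=> /andP[/eqP -> /eqP ->].
Qed.

(** For a projection the trace is its square norm, which dominates the square of any nonzero
    coefficient. *)
Lemma tr_proj_gt0 (a : galg R U) : a * a = a -> star a = a -> a <> 0 ->
  0 < complex.Re (a 1%g).
Proof.
move=> aa sa a0; have [g ag] : exists g, a g != 0.
  apply: contra_notP a0 => a0; apply: galg_eq => g; apply/eqP.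
  by apply: contra_notT a0 => ag; exists g.
have := sqnormc_le_tr a g; rewrite sa aa; apply: lt_le_trans.
exact: sqnormc_gt0.
Qed.

(** Positivity of the trace, applied to [e] and to [1 - e], places it strictly between 0 and 1;
    self-adjointness makes it real. *)
Lemma nontriv_proj_galg (e : U -> R[i]) : nontriv_proj e ->
  exists e0 : galg R U, [/\ gval e0 = e, e0 * e0 = e0, star e0 = e0,
    e0 1%g = (complex.Re (gtr e))%:C%C & 0 < complex.Re (gtr e) < 1].
Proof.
case=> fe ee se e0 e1; exists (GAlg fe).
have ee' : GAlg fe * GAlg fe = GAlg fe by apply: galg_eq => g; rewrite gvalM /= ee.
have se' : star (GAlg fe) = GAlg fe by apply: galg_eq => g; rewrite /= se.
split=> //.
  have := congr1 (fun a : galg R U => a 1%g) se'; rewrite gval_star invg1 /= /gtr.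
  by case: (e 1%g) => [x y] /= [] yN; congr Complex; lra.
apply/andP; split.
  by apply: (tr_proj_gt0 ee' se') => /(congr1 (@gval R U)) /= E; apply: e0.
rewrite -subr_gt0; have := @tr_proj_gt0 (1 - GAlg fe).
rewrite gvalB gval1 eqxx raddfB; apply.
- by rewrite mulrBr mulr1 mulrBl mul1r ee' subrr subr0.
- by rewrite starD starN star1 se'.
- move=> /eqP; rewrite subr_eq0 => /eqP /(congr1 (@gval R U)) /= E.
  by apply: e1; rewrite -E.
Qed.

End ProjectionTrace.

Section ProductGroup.
Variables (R : realType) (A B : groupType).

Lemma inl_gM : {morph @inl_g A B : x y / (x * y)%g}.
Proof. by move=> x y; rewrite -[RHS]/(GPair (x * y)%g (1 * 1)%g) mulg1. Qed.

Lemma inr_gM : {morph @inr_g A B : x y / (x * y)%g}.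
Proof. by move=> x y; rewrite -[RHS]/(GPair (1 * 1)%g (x * y)%g) mulg1. Qed.

Lemma inl_g_inj : injective (@inl_g A B). Proof. by move=> x y []. Qed.
Lemma inr_g_inj : injective (@inr_g A B). Proof. by move=> x y []. Qed.

Lemma gprod_mulE (x y : gprod A B) : (x * y)%g = GPair (gfst x * gfst y)%g (gsnd x * gsnd y)%g.
Proof. by []. Qed.

Lemma push_comm (a : galg R A) (b : galg R B) :
  gpush (@inl_g A B) a * gpush (@inr_g A B) b = gpush (@inr_g A B) b * gpush (@inl_g A B) a.
Proof.
apply: comm_supp => x y /gpush_supp[h _ ->] /gpush_supp[k _ ->].
by rewrite !gprod_mulE /= !mulg1 !mul1g.
Qed.

Lemma push_tr (a : galg R A) (b : galg R B) :
  (gpush (@inl_g A B) a * gpush (@inr_g A B) b) 1%g = a 1%g * b 1%g.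
Proof.
rewrite trM_indep => [|x y /gpush_supp[h _ ->] /gpush_supp[k _ ->]].
  by rewrite -[a _](gpush_val a _ inl_g_inj) -[b _](gpush_val b _ inr_g_inj).
by rewrite gprod_mulE /= mulg1 mul1g => -[-> _].
Qed.

End ProductGroup.

Unset Implicit Arguments.
Set Strict Implicit.
Set Printing Implicit Defensive.
Local Close Scope ring_scope.

Theorem theorem4p1 (R : realType) (U V : groupType)
    (e : U -> R[i]) (f : V -> R[i]) :
  has_torsion U -> has_torsion V ->
  nontriv_proj e -> nontriv_proj f ->
  let X : R := ((complex.Re (gtr e))^-1)%R in
  let Y : R := ((complex.Re (gtr f))^-1)%R in
  let GU := wreath U in
  let GV := wreath V in
  let G := gprod GU GV in
  (* e, f viewed in C[U wr Z], C[V wr Z] *)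
  let eU : GU -> R[i] := push (@wembed U) e in
  let fV : GV -> R[i] := push (@wembed V) f in
  let tU : GU := wgen U in
  let tV : GV := wgen V in
  (* T = e t_U + t_U^{-1} e,  S = f t_V + t_V^{-1} f *)
  let T0 : GU -> R[i] :=
    fun g => (conv eU (@delta R _ tU) g + conv (@delta R _ (tU^-1)%g) eU g)%R in
  let S0 : GV -> R[i] :=
    fun g => (conv fV (@delta R _ tV) g + conv (@delta R _ (tV^-1)%g) fV g)%R in
  (* their images in C[G] *)
  let T : G -> R[i] := push (@inl_g GU GV) T0 in
  let S : G -> R[i] := push (@inr_g GU GV) S0 in
  let TmS : G -> R[i] := fun g => (T g - S g)%R in
  exists xi : G -> R[i],
    is_orth_proj (l2ker TmS) (@delta R G 1%g) xi /\
    complex.Im (gtr xi) = 0%R /\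
    ((complex.Re (gtr xi))%:E =
       ((X - 1) ^+ 2 * (Y - 1) ^+ 2)%:E * gcd_series X Y
       - ((X - 1) * (Y - 1))%:E)%E.
Proof.
move=> _ _ /nontriv_proj_galg[e0 [<- ee se te /andP[p0 p1]]].
move=> /nontriv_proj_galg[f0 [<- ff sf tf /andP[q0 q1]]] X Y GU GV G.
have X1 : (1 < X)%R by rewrite invf_gt1.
have Y1 : (1 < Y)%R by rewrite invf_gt1.
have [ell -> cell] := gcd_series_cvg X1 Y1.
have lim := cvg_kernel_trace X1 Y1 cell; rewrite !invrK in lim.
have puU := push_path_units (@inl_gM GU GV) (wreath_path_units ee se).
have puV := push_path_units (@inr_gM GU GV) (wreath_path_units ff sf).
set p := complex.Re (gtr e0) in p0 p1 te lim *; set q := complex.Re (gtr f0) in q0 q1 tf lim *.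
have [] := @path_units_kernel R G _ _ _ _ (fun m => (1 - p) ^+ 2 * p ^+ m)%R
  (fun n => (1 - q) ^+ 2 * q ^+ n)%R _ puU puV _ _ _ _ _ lim.
- by move=> m i j n k l; exact: push_comm.
- by move=> m i j; rewrite push_comm.
- move=> m i j n k l; rewrite push_tr (path_unit_tr te) (path_unit_tr tf).
  by case: eqP => _; case: eqP => _ /=; rewrite ?mul0r ?mulr0 ?rmorphM.
- by apply: cvg_arith_geometric; rewrite p0.
- by apply: cvg_arith_geometric; rewrite q0.
(* The ring expression for the difference of the two shift operators unfolds to [TmS] by
   conversion. *)
move=> xi [orth xi1]; exists xi; split; first exact: orth.
by rewrite /gtr xi1 /= EFinB EFinM.
Qed.
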